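(* Let $X=\ell_q$ (complex) with $2<q<\infty$. The Baire spaces $(\mathcal{P}_1(X),\mathrm{SOT})$ and $(\mathcal{P}_1(X),\mathrm{SOT}^* )$ have the same comeager sets.
   Context: $X=\ell_q=\ell_q(\mathbb{Z}_+)$ is equipped with its canonical basis. A vector is positive if all its coordinates are $\ge0$; a bounded operator $T$ on $X$ is positive if it maps positive vectors to positive vectors. $\mathcal{P}_1(X)$ is the set of bounded positive operators with $\|T\|\le1$. $\mathrm{SOT}$: $T_i\to T$ iff $\|T_ix-Tx\|\to0$ for every $x\in X$. $\mathrm{SOT}^*$: $T_i\to T$ iff $\|T_ix-Tx\|\to0$ for every $x\in X$ and $\|T_i^*x^*-T^*x^*\|\to0$ for every $x^*\in X^*$. A set is comeager if it contains a dense $G_\delta$ subset of the space. *)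

(* Defs.v *)
From HB Require Import structures.
From mathcomp Require Import all_boot all_order all_algebra.
From mathcomp Require Import all_classical all_reals all_analysis.
From mathcomp Require Import borel_hierarchy complex.

Set Implicit Arguments.
Unset Strict Implicit.
Unset Printing Implicit Defensive.

Import Order.TTheory GRing.Theory Num.Theory.
Import numFieldNormedType.Exports.

Local Open Scope classical_set_scope.
Local Open Scope complex_scope.
Local Open Scope ring_scope.

(* Norms of normed spaces over R[i] take their values in R[i]; they are real
   and nonnegative, and Rnorm is the same number as an element of R. *)
Definition Rnorm (R : realType) (X : normedModType R[i]) (x : X) : R :=
  complex.Re `|x|.

Section Rnorm_theory.
Context {R : realType} {X : normedModType R[i]}.
Implicit Types x y : X.

Lemma RnormE x : `|x| = (Rnorm x)%:C.
Proof.
have := normr_ge0 x; rewrite /Rnorm; case: (`|x|) => a b.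
by rewrite lecE /= => /andP[/eqP-> _].
Qed.

Lemma Rnorm_ge0 x : 0 <= Rnorm x.
Proof. by have := normr_ge0 x; rewrite RnormE ler0c. Qed.

Lemma Rnorm0 : Rnorm (0 : X) = 0.
Proof. by rewrite /Rnorm normr0. Qed.

Lemma Rnorm0_eq0 x : Rnorm x = 0 -> x = 0.
Proof. by move=> x0; apply/normr0_eq0; rewrite RnormE x0. Qed.

Lemma ler_RnormD x y : Rnorm (x + y) <= Rnorm x + Rnorm y.
Proof. by have := ler_normD x y; rewrite !RnormE -rmorphD /= lecR. Qed.

Lemma RnormZ (a : R[i]) x : Rnorm (a *: x) = ComplexField.Normc.normc a * Rnorm x.
Proof.
apply: (@complexI R); rewrite -RnormE normrZ RnormE rmorphM /=.
by congr (_ * _); case: a.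
Qed.

End Rnorm_theory.

Section bounded_operators.
Context (R : realType) (X Y : normedModType R[i]).

Definition bounded_op : {pred X -> Y} := fun f =>
  `[< linear f /\ exists C : R, forall x, Rnorm (f x) <= C * Rnorm x >].

Lemma bounded_op_submod_closed : submod_closed bounded_op.
Proof.
split=> [|a f g /asboolP[lf [C Cf]] /asboolP[lg [D Dg]]]; apply/asboolP; split.
- by move=> a x y; rewrite /= scaler0 addr0.
- by exists 0 => x; rewrite mul0r Rnorm0.
- move=> b x y /=.
  rewrite [in LHS]/GRing.add /= [in LHS]/GRing.scale /= lf lg.
  rewrite [in RHS]/GRing.add /= [in X in _ *: (X + _) + _]/GRing.scale /=.
  rewrite [in X in _ + (X + _)]/GRing.scale /=.
  by rewrite !scalerDr !scalerA [a * b]mulrC addrACA.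
- exists (ComplexField.Normc.normc a * C + D) => x.
  rewrite [X in Rnorm X](_ : _ = a *: f x + g x)//.
  rewrite (le_trans (ler_RnormD _ _))// RnormZ mulrDl lerD// -mulrA ler_wpM2l//.
  by case: a => ? ?; rewrite sqrtr_ge0.
Qed.
HB.instance Definition _ :=
  GRing.isSubmodClosed.Build _ _ bounded_op bounded_op_submod_closed.

Record bop := Bop { bop_fun :> X -> Y; _ : bop_fun \in bounded_op }.
HB.instance Definition _ := [isSub for bop_fun].
HB.instance Definition _ := [Choice of bop by <:].
HB.instance Definition _ := [SubChoice_isSubLmodule of bop by <:].


Lemma bop_is_linear (T : bop) : linear T.
Proof. by case: T => f /= /asboolP[]. Qed.
HB.instance Definition _ (T : bop) :=
  GRing.isLinear.Build _ _ _ _ (bop_fun T) (bop_is_linear T).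

Lemma bopP (T : bop) : exists C : R, forall x, Rnorm (T x) <= C * Rnorm x.
Proof. by case: T => f /= /asboolP[]. Qed.

Definition opnorm (T : bop) : R :=
  sup [set Rnorm (T x) | x in [set x | Rnorm x <= 1]].

Lemma has_sup_opnorm (T : bop) :
  has_sup [set Rnorm (T x) | x in [set x | Rnorm x <= 1]].
Proof.
split; first by exists (Rnorm (T 0)), 0; rewrite /= ?Rnorm0.
have [C TC] := bopP T; exists `|C| => _ [x /= x1 <-].
rewrite (le_trans (TC x))// -[leRHS]mulr1 (le_trans (ler_norm _))//.
by rewrite normrM ler_wpM2l// ger0_norm ?Rnorm_ge0.
Qed.

Lemma opnorm_ge0 (T : bop) : 0 <= opnorm T.
Proof.
apply: (le_trans (Rnorm_ge0 (T 0))); apply: ub_le_sup.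
  by have [] := has_sup_opnorm T.
by exists 0; rewrite /= ?Rnorm0.
Qed.

Lemma Rnorm_le_opnorm (T : bop) x : Rnorm (T x) <= opnorm T * Rnorm x.
Proof.
have [x0|x0] := eqVneq (Rnorm x) 0.
  by rewrite (Rnorm0_eq0 x0) linear0 !Rnorm0 mulr0.
have x_gt0 : 0 < Rnorm x by rewrite lt_neqAle eq_sym x0 Rnorm_ge0.
rewrite -ler_pdivrMr//.
have nV : ComplexField.Normc.normc (Rnorm x)%:C^-1 = (Rnorm x)^-1.
  by rewrite ComplexField.Normc.normcV /= expr0n addr0 sqrtr_sqr gtr0_norm.
have -> : Rnorm (T x) / Rnorm x = Rnorm (T ((Rnorm x)%:C^-1 *: x)).
  by rewrite linearZ RnormZ nV mulrC.
apply: ub_le_sup; first by have [] := has_sup_opnorm T.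
by exists ((Rnorm x)%:C^-1 *: x) => //=; rewrite RnormZ nV mulVf.
Qed.

Lemma opnorm_le (T : bop) (C : R) :
  (forall x, Rnorm x <= 1 -> Rnorm (T x) <= C) -> opnorm T <= C.
Proof.
move=> TC; apply: ge_sup; first by have [] := has_sup_opnorm T.
by move=> _ [x /= x1 <-]; exact: TC.
Qed.

Let bop_norm (T : bop) : R[i] := (opnorm T)%:C.

Let bop_normD S T : bop_norm (S + T) <= bop_norm S + bop_norm T.
Proof.
rewrite /bop_norm -rmorphD /= lecR; apply: opnorm_le => x x1.
rewrite (le_trans (ler_RnormD _ _))// lerD// (le_trans (Rnorm_le_opnorm _ _))//.
  by rewrite ler_piMr ?opnorm_ge0.
by rewrite ler_piMr ?opnorm_ge0.
Qed.

Let opnormZ_le (a : R[i]) T :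
  opnorm (a *: T) <= ComplexField.Normc.normc a * opnorm T.
Proof.
have a0 : 0 <= ComplexField.Normc.normc a by case: a => ? ?; rewrite sqrtr_ge0.
apply: opnorm_le => x x1; rewrite [X in Rnorm X](_ : _ = a *: T x)// RnormZ.
rewrite ler_wpM2l// (le_trans (Rnorm_le_opnorm _ _))//.
by rewrite ler_piMr ?opnorm_ge0.
Qed.

Let bop_normZ (a : R[i]) T : bop_norm (a *: T) = `|a| * bop_norm T.
Proof.
rewrite /bop_norm [`|a|](_ : _ = (ComplexField.Normc.normc a)%:C); last by case: a.
rewrite -rmorphM /=; congr (_%:C); apply/eqP; rewrite eq_le opnormZ_le /=.
have [->|a0] := eqVneq a 0.
  by rewrite ComplexField.Normc.normc0 mul0r opnorm_ge0.
have na0 : 0 < ComplexField.Normc.normc a.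
  rewrite lt_neqAle eq_sym (contra_neq (@ComplexField.Normc.eq0_normc _ a))//=.
  by case: a {a0} => ? ?; rewrite sqrtr_ge0.
rewrite mulrC -ler_pdivlMr// mulrC -ComplexField.Normc.normcV.
by rewrite -{1}[T](scalerK a0) opnormZ_le.
Qed.

Let bop_norm0_eq0 T : bop_norm T = 0 -> T = 0.
Proof.
move=> /complexI T0; apply/val_inj/funext => x; apply: Rnorm0_eq0.
by apply/eqP; rewrite eq_le Rnorm_ge0 andbT (le_trans (Rnorm_le_opnorm _ _))// T0 mul0r.
Qed.

HB.instance Definition _ :=
  Lmodule_isNormed.Build R[i] bop bop_normD bop_normZ bop_norm0_eq0.

Lemma Rnorm_bop (T : bop) : Rnorm T = opnorm T.
Proof. by []. Qed.

End bounded_operators.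

Definition dual (R : realType) (X : normedModType R[i]) := bop X R[i]^o.

Section adjoint.
Context (R : realType) (X Y : normedModType R[i]) (T : bop X Y).

Lemma adjoint_subproof (f : dual Y) : (f \o T : X -> R[i]^o) \in @bounded_op R X R[i]^o.
Proof.
apply/asboolP; split; first by move=> a x y /=; rewrite !linearP.
exists (opnorm f * opnorm T) => x /=.
rewrite (le_trans (Rnorm_le_opnorm _ _))// -mulrA ler_wpM2l ?opnorm_ge0//.
exact: Rnorm_le_opnorm.
Qed.

Definition adjoint (f : dual Y) : dual X := Bop (adjoint_subproof f).

End adjoint.

Section lq.
Context (R : realType) (q : R) (q1 : 1 <= q).
Implicit Types x y : nat -> R[i]^o.

Let q0 : 0 < q. Proof. exact: lt_le_trans q1. Qed.

Definition lq_enorm x : \bar R :=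
  Lnorm counting q%:E (fun n => (Rnorm (x n))%:E).

Lemma lq_enormE x :
  lq_enorm x = ((\sum_(n <oo) (Rnorm (x n) `^ q)%:E) `^ q^-1)%E.
Proof.
rewrite /lq_enorm Lnorm_counting//; congr (_ `^ _)%E.
by apply: eq_eseriesr => n _; rewrite gee0_abs ?lee_fin ?Rnorm_ge0.
Qed.

Lemma lq_enorm_ge0 x : (0 <= lq_enorm x)%E.
Proof. exact: Lnorm_ge0. Qed.

Lemma lq_enorm0 : lq_enorm 0 = 0%E.
Proof.
rewrite lq_enormE eseries0 ?poweR0r ?gt_eqF ?invr_gt0// => n _ _.
by rewrite Rnorm0 powR0 ?gt_eqF.
Qed.

Lemma lq_enormD x y : (lq_enorm (x + y)%R <= lq_enorm x + lq_enorm y)%E.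
Proof.
pose f n : R := Rnorm (x n); pose g n : R := Rnorm (y n).
have fg : ('N[counting]_q%:E[EFin \o (f \+ g)%R] <= lq_enorm x + lq_enorm y)%E.
  by apply: minkowski_EFin => //; move=> ? ? ?.
apply: le_trans fg.
rewrite /lq_enorm !Lnorm_counting//.
have S0 (h : nat -> R) : (0 <= \sum_(k <oo) `|(h k)%:E| `^ q)%E.
  by apply: nneseries_ge0 => n *; rewrite poweR_ge0.
apply: gt0_ler_poweR; first by rewrite invr_ge0 ltW.
- by rewrite in_itv /= S0 leey.
- by rewrite in_itv /= leey andbT; exact: (S0 (f \+ g)).
apply: lee_nneseries => n *; first by rewrite poweR_ge0.
rewrite [in leRHS]/= !gee0_abs ?lee_fin ?addr_ge0 ?Rnorm_ge0//.
apply: ge0_ler_powR; rewrite ?nnegrE ?addr_ge0 ?Rnorm_ge0//; first exact: ltW.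
by rewrite (le_trans _ (ler_norm _))//; exact: ler_RnormD.
Qed.

Lemma lq_enormZ (a : R[i]) x :
  (lq_enorm (a *: x)%R = (ComplexField.Normc.normc a)%:E * lq_enorm x)%E.
Proof.
have a0 : 0 <= ComplexField.Normc.normc a by case: a => ? ?; rewrite sqrtr_ge0.
rewrite !lq_enormE.
rewrite (@eq_eseriesr _ _ (fun n => ((ComplexField.Normc.normc a `^ q)%:E *
   (Rnorm (x n) `^ q)%:E)%E)); last first.
  move=> n _; rewrite -EFinM -powRM ?Rnorm_ge0//; congr ((_ `^ _)%:E).
  by rewrite -RnormZ.
rewrite nneseriesZl//; last by move=> n _; rewrite lee_fin powR_ge0.
rewrite poweRM ?nneseries_ge0// ?lee_fin ?powR_ge0//; last first.
  by move=> *; rewrite lee_fin powR_ge0.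
by rewrite poweR_EFin -powRrM mulfV ?gt_eqF// powRr1.
Qed.

Lemma lq_enorm_eq0 x : lq_enorm x = 0%E -> x = 0.
Proof.
have f0 n : (0 <= (Rnorm (x n) `^ q)%:E)%E by rewrite lee_fin powR_ge0.
rewrite lq_enormE => /poweR_eq0_eq0.
rewrite nneseries_ge0// => /(_ isT) s0; apply/funext => n; apply: Rnorm0_eq0.
have : ((Rnorm (x n) `^ q)%:E <= 0)%E.
  by rewrite -s0 (@nneseriesD1 _ _ n)// leeDl// nneseries_ge0.
rewrite lee_fin => xn0; apply/eqP.
suff : Rnorm (x n) `^ q == 0 by rewrite powR_eq0 => /andP[].
by rewrite eq_le xn0 powR_ge0.
Qed.

(* The proof of 1 <= q is an argument so that it can be recovered from the
   type of the space when its norm is inferred. *)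
Definition lq_pred (_ : 1 <= q) : {pred nat -> R[i]^o} :=
  fun x => (lq_enorm x < +oo)%E.

Lemma lq_submod_closed : submod_closed (lq_pred q1).
Proof.
split=> [|a x y]; rewrite !unfold_in; first by rewrite lq_enorm0.
move=> xoo yoo; rewrite (le_lt_trans (lq_enormD _ _))// lte_add_pinfty//.
by rewrite lq_enormZ lte_mul_pinfty// lee_fin; case: a => ? ?; rewrite sqrtr_ge0.
Qed.
HB.instance Definition _ :=
  GRing.isSubmodClosed.Build _ _ (lq_pred q1) lq_submod_closed.

Record lq := Lq { lq_seq :> nat -> R[i]^o; _ : lq_seq \in lq_pred q1 }.
HB.instance Definition _ := [isSub for lq_seq].
HB.instance Definition _ := [Choice of lq by <:].
HB.instance Definition _ := [SubChoice_isSubLmodule of lq by <:].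

Definition lq_norm (x : lq) : R := fine (lq_enorm x).

Lemma lq_normK (x : lq) : (lq_norm x)%:E = lq_enorm x.
Proof. by rewrite fineK// ge0_fin_numE ?lq_enorm_ge0//; case: x. Qed.

Let lq_cnorm (x : lq) : R[i] := (lq_norm x)%:C.

Let lq_cnormD (x y : lq) : lq_cnorm (x + y) <= lq_cnorm x + lq_cnorm y.
Proof.
by rewrite /lq_cnorm -rmorphD /= lecR -lee_fin EFinD !lq_normK lq_enormD.
Qed.

Let lq_cnormZ (a : R[i]) (x : lq) : lq_cnorm (a *: x) = `|a| * lq_cnorm x.
Proof.
rewrite /lq_cnorm [`|a|](_ : _ = (ComplexField.Normc.normc a)%:C); last by case: a.
rewrite -rmorphM /=; congr (_%:C); apply: EFin_inj.
by rewrite EFinM !lq_normK -lq_enormZ.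
Qed.

Let lq_cnorm0_eq0 (x : lq) : lq_cnorm x = 0 -> x = 0.
Proof.
move=> /complexI x0; apply/val_inj/lq_enorm_eq0.
by rewrite -lq_normK x0.
Qed.

HB.instance Definition _ :=
  Lmodule_isNormed.Build R[i] lq lq_cnormD lq_cnormZ lq_cnorm0_eq0.

Lemma Rnorm_lq (x : lq) : Rnorm x = lq_norm x.
Proof. by []. Qed.

End lq.

Section positive_contractions.
Context (R : realType) (q : R) (q1 : 1 <= q).

(* In R[i], 0 <= z means that z is real and nonnegative. *)
Definition positive_vec (x : lq q1) : Prop := forall n, 0 <= (x n : R[i]).

Definition positive_op (T : bop (lq q1) (lq q1)) : Prop :=
  forall x, positive_vec x -> positive_vec (T x).

Definition P1 : set (bop (lq q1) (lq q1)) :=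
  [set T | positive_op T /\ opnorm T <= 1].

End positive_contractions.
Arguments P1 {R q} q1 _ : assert.

(* cvg_sotP and cvg_sot_starP below identify the convergent filters. *)
Section operator_topologies.
Context (R : realType) (X : normedModType R[i]) (A : set (bop X X)).

Definition sot : topologicalType :=
  initial_topology (fun T : A => (\val T : bop X X) : {ptws X -> X}).

Definition sot_star : topologicalType :=
  initial_topology (fun T : A =>
    ((\val T : bop X X) : {ptws X -> X},
     adjoint (\val T) : {ptws dual X -> dual X})).

End operator_topologies.

Lemma cvg_initialP (S : choiceType) (T : topologicalType) (f : S -> T)
    (F : set_system (initial_topology f)) (s : initial_topology f) :
  Filter F -> F --> s <-> f @ F --> f s.
Proof.
move=> FF; split=> [Fs|fFs].
  by apply: cvg_comp Fs _; exact: initial_continuous.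
move=> B; rewrite nbhsE => -[C [[D oD <-] Ds] DB].
apply: (filterS DB); apply: fFs; exact: open_nbhs_nbhs.
Qed.

Lemma cvg_RnormP (R : realType) (X : normedModType R[i]) (I : Type)
    (F : set_system I) (f : I -> X) (l : X) : Filter F ->
  f @ F --> l <-> Rnorm (f i - l) @[i --> F] --> (0 : R).
Proof.
move=> FF; split=> [/cvgrPdist_lt fl|/cvgrPdist_lt fl].
  apply/cvgrPdist_lt => e e0.
  have /fl : 0 < e%:C by rewrite ltcE /= eqxx.
  by apply: filterS => i; rewrite sub0r normrN distrC RnormE ltcR ger0_norm ?Rnorm_ge0.
apply/cvgrPdist_lt => -[e e']; rewrite ltcE /= => /andP[/eqP-> e0].
have := fl _ e0; apply: filterS => i.
by rewrite sub0r normrN distrC RnormE ger0_norm ?Rnorm_ge0// -ltcR.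
Qed.

Lemma cvg_sotP (R : realType) (X : normedModType R[i]) (A : set (bop X X))
    (F : set_system (sot A)) (T : sot A) : Filter F ->
  F --> T <->
  forall x, Rnorm ((\val S : bop X X) x - (\val T : bop X X) x) @[S --> F] --> (0 : R).
Proof.
move=> FF; rewrite cvg_initialP; split.
  by move=> /pointwise_cvgP h x; apply/cvg_RnormP; exact: h.
by move=> h; apply/pointwise_cvgP => x; apply/cvg_RnormP; exact: h.
Qed.

Lemma cvg_sot_starP (R : realType) (X : normedModType R[i]) (A : set (bop X X))
    (F : set_system (sot_star A)) (T : sot_star A) : Filter F ->
  F --> T <->
  (forall x : X, Rnorm ((\val S : bop X X) x - (\val T : bop X X) x)
     @[S --> F] --> (0 : R)) /\
  (forall f : dual X, Rnorm (adjoint (\val S) f - adjoint (\val T) f)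
     @[S --> F] --> (0 : R)).
Proof.
move=> FF; rewrite cvg_initialP; split=> [h|[h1 h2]].
  split=> [x|f]; apply/cvg_RnormP.
    have : {ptws, (fun S : A => (\val S : bop X X) : X -> X) @ F -->
              ((\val T : bop X X) : X -> X)}.
      by apply: (cvg_comp _ fst h); exact: cvg_fst.
    by move=> /pointwise_cvgP; exact.
  have : {ptws, (fun S : A => adjoint (\val S) : dual X -> dual X) @ F -->
            (adjoint (\val T) : dual X -> dual X)}.
    by apply: (cvg_comp _ snd h); exact: cvg_snd.
  by move=> /pointwise_cvgP; exact.
have H1 : {ptws, (fun S : A => (\val S : bop X X) : X -> X) @ F -->
           ((\val T : bop X X) : X -> X)}.
  by apply/pointwise_cvgP => x; apply/cvg_RnormP; exact: h1.
have H2 : {ptws, (fun S : A => adjoint (\val S) : dual X -> dual X) @ F -->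
           (adjoint (\val T) : dual X -> dual X)}.
  by apply/pointwise_cvgP => f; apply/cvg_RnormP; exact: h2.
move=> B [[B1 B2] /= [nB1 nB2] sB].
have F1 := H1 _ nB1; have F2 := H2 _ nB2.
have F12 := @filterI _ F FF _ _ F1 F2.
by apply: (@filterS _ F FF _ _ _ F12) => S [B1S B2S]; apply: (sB (_, _)); split.
Qed.

Lemma ltr2_ler1 (R : realType) (q : R) : 2 < q -> 1 <= q.
Proof. by move=> q2; rewrite ltW// (lt_trans _ q2)// ltr1n. Qed.

Definition baire (T : topologicalType) : Prop :=
  forall U : (set T)^nat, (forall n, open (U n) /\ dense (U n)) ->
  dense (\bigcap_n U n).

Definition comeager (T : topologicalType) (A : set T) : Prop :=
  exists G : set T, [/\ Gdelta G, dense G & G `<=` A].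

(* Main.v *)
Require Import Defs.
From mathcomp Require Import all_boot all_order all_algebra.
From mathcomp Require Import all_classical all_reals all_analysis.
From mathcomp Require Import borel_hierarchy complex ring lra.

Set Implicit Arguments.
Unset Strict Implicit.
Unset Printing Implicit Defensive.

Import Order.TTheory GRing.Theory Num.Theory.
Import numFieldNormedType.Exports.

Local Open Scope classical_set_scope.
Local Open Scope ring_scope.

(** Comeagerness can be compared as soon as both spaces are Baire and every
nonempty SOT*-open set contains a nonempty SOT-open set
(comeager_transfer): SOT* being finer, a SOT-open dense set is then still dense
for SOT*, and the SOT-interior of a SOT*-open dense set is still dense for
SOT.

Everything happens on matrices.  A positive contraction of the sequence space
is the same thing as an infinite matrix with nonnegative entries satisfying the
finite contractivity inequalities (mx_of_contractive, op_of_mx).  Near a given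
operator, SOT controls finitely many columns in the norm of the space, and SOT*
controls in addition finitely many rows in the dual norm (nbhs_sotP,
nbhs_sot_starP); the dual statement rests on the fact that a bounded functional
has vanishing tails, because the exponent exceeds 1 (row_tail).  These
conditions are closed under entrywise limits, and the contractivity
inequalities too, so both spaces are complete enough for nested neighbourhoods
to meet, which makes them Baire (baire_of_mx_near).

What remains is to find, arbitrarily close to a contractive matrix a for SOT*, a
contractive matrix b such that every contractive c whose columns are close to
those of b has its first rows close to those of b.  A finite matrix b that
attains its norm at a vector x with strictly positive coordinates, with b x
strictly positive too, does this (norming_rigid).  Indeed, if c is close to b
then the norm of c x is nearly that of x; for a nonnegative y of norm at most
1 supported off x, contractivity bounds the q-th power of the norm of
c (x + t y) by that of x plus t ^ q, whereas the j-th coordinate alone makes it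
grow at first order by t (c x)_j ^ (q - 1) (c y)_j.  As q > 1, small t force
(c y)_j to be small: the rows of c have small tails.  Positivity is what allows
a first-order argument with a single sign.

Such matrices b are dense for SOT* (norming_extension).  Truncate and shrink a
to a finite matrix of norm less than 1, and add one coordinate.  For a small
t > 0 there is a strictly positive solution u of the nonlinear Perron equation
u ^ (q - 1) = t + a^T (a u + t) ^ (q - 1), obtained as a greatest fixed point
(fixed_vector).  The entries of the new row and column can then be chosen
explicitly, small except in the corner, so that x = (u, 1) satisfies
b^T (b x) ^ (q - 1) = x ^ (q - 1).  By Schur's test (schur_test) b is
contractive, and pairing this equation with x shows that b attains its norm at
x. *)

(** * Powers, finite sums and tails *)

Section powers.
Context {R : realType} {q : R}.
Hypothesis q_gt1 : 1 < q.
Implicit Types s t : R.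

Let q_gt0 : 0 < q. Proof. exact: lt_trans q_gt1. Qed.
Let qB1_gt0 : 0 < q - 1. Proof. by rewrite subr_gt0. Qed.

Lemma le_powR (p s t : R) : 0 <= p -> 0 <= s -> s <= t -> s `^ p <= t `^ p.
Proof. by move=> p0 s0 st; apply: ge0_ler_powR => //; rewrite nnegrE// (le_trans s0). Qed.

Lemma powR_le_powR (p s t : R) : 0 < p -> 0 <= s -> 0 <= t ->
  s `^ p <= t `^ p -> s <= t.
Proof.
move=> p0 s0 t0 st; rewrite leNgt; apply/negP => ts.
by move: st; rewrite leNgt => /negP; apply; apply: gt0_ltr_powR; rewrite ?nnegrE.
Qed.

Lemma powRVK (p s : R) : 0 < p -> 0 <= s -> (s `^ p^-1) `^ p = s.
Proof. by move=> p0 s0; rewrite -powRrM mulVf ?gt_eqF// powRr1. Qed.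

Lemma powR_le1 s : 0 <= s -> s `^ q <= 1 -> s <= 1.
Proof. by move=> s0 sq; apply: (@powR_le_powR q); rewrite ?powR1. Qed.

Lemma le_powR1D s : 0 <= s -> s <= 1 + s `^ q.
Proof.
move=> s0; have [s1|/ltW s1] := leP s 1; first by rewrite (le_trans s1)// lerDl powR_ge0.
by rewrite (le_trans (le1r_powR s1 (ltW q_gt1)))// lerDr.
Qed.

Lemma powRB1M s : 0 <= s -> s `^ (q - 1) * s = s `^ q.
Proof. by move=> s0; rewrite mulrC mulr_powRB1. Qed.

(** The constant in front of the first power can be taken as close to 1 as
desired: either t is at most e s, or s is less than t / e. *)
Lemma powRD_weighted e s t : 0 < e -> 0 <= s -> 0 <= t ->
  (s + t) `^ q <= (1 + e) `^ q * s `^ q + (1 + e^-1) `^ q * t `^ q.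
Proof.
move=> e0 s0 t0; have e0' : 0 < e^-1 by rewrite invr_gt0.
have [e1 e1'] : 0 <= 1 + e /\ 0 <= 1 + e^-1 by split; lra.
rewrite -!powRM//.
have [te|st] := leP t (e * s).
- apply: (@le_trans _ _ (((1 + e) * s) `^ q)).
    by apply: le_powR; rewrite ?addr_ge0 ?(ltW q_gt0)//; lra.
  by rewrite lerDl powR_ge0.
- apply: (@le_trans _ _ (((1 + e^-1) * t) `^ q)); last by rewrite lerDr powR_ge0.
  apply: le_powR; rewrite ?addr_ge0 ?(ltW q_gt0)//.
  suff : s < e^-1 * t by lra.
  by rewrite mulrC ltr_pdivlMr// mulrC.
Qed.

Lemma powRD_le2 s t : 0 <= s -> 0 <= t ->
  (s + t) `^ q <= 2 `^ q * (s `^ q + t `^ q).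
Proof.
move=> s0 t0; rewrite mulrDr (le_trans (powRD_weighted ltr01 s0 t0))//.
by rewrite invr1.
Qed.

(** A first-order lower bound: it is compared with a term t ^ q, which is
negligible for small t because q > 1. *)
Lemma powRD_ge s t : 0 <= s -> 0 <= t -> s `^ q + s `^ (q - 1) * t <= (s + t) `^ q.
Proof.
move=> s0 t0; rewrite -(powRB1M s0) -(powRB1M (addr_ge0 s0 t0)) -mulrDr.
by apply: ler_wpM2r; rewrite ?addr_ge0//; apply: le_powR; rewrite ?lerDl// ltW.
Qed.

Lemma young_powRB1 s t : 0 <= s -> 0 <= t ->
  s `^ (q - 1) * t <= (1 - q^-1) * s `^ q + q^-1 * t `^ q.
Proof.
move=> s0 t0; have p0 : 0 < q / (q - 1) by rewrite divr_gt0.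
have pV : (q / (q - 1))^-1 = 1 - q^-1 by rewrite invf_div; field; rewrite gt_eqF.
have := @conjugate_powR _ (s `^ (q - 1)) t _ _ (powR_ge0 _ _) t0 p0 q_gt0.
rewrite pV subrK => /(_ erefl).
rewrite -powRrM mulrCA mulfV ?gt_eqF// mulr1.
by rewrite [_ * (1 - _)]mulrC [_ * q^-1]mulrC.
Qed.

Lemma young_weak s t : 0 <= s -> 0 <= t -> s * t <= s `^ (q / (q - 1)) + t `^ q.
Proof.
move=> s0 t0; have p0 : 0 < q / (q - 1) by rewrite divr_gt0.
have pV : (q / (q - 1))^-1 = 1 - q^-1 by rewrite invf_div; field; rewrite gt_eqF.
have := @conjugate_powR _ s t _ _ s0 t0 p0 q_gt0.
rewrite pV subrK => /(_ erefl)/le_trans; apply; apply: lerD.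
  rewrite ler_piMr ?powR_ge0//.
  have : 0 <= q^-1 by rewrite invr_ge0 ltW.
  by lra.
by rewrite ler_piMr ?powR_ge0// invf_le1// ltW.
Qed.

(** powR equals 1 at negative numbers, so that continuity at 0 holds
only along nonnegative sequences. *)
Lemma cvg_powR (f : nat -> R) (l : R) : (forall n, 0 <= f n) -> f @ \oo --> l ->
  f n `^ q @[n --> \oo] --> l `^ q.
Proof.
move=> f0 fl; have l0 : 0 <= l.
  by apply: (cvgr_to_ge fl); near=> n; exact: f0.
have [l_gt0|] := ltP 0 l.
  have lq : {for l, continuous (fun x : R => x `^ q)}.
    apply: differentiable_continuous; apply/derivable1_diffP.
    by apply: derivable_powR; rewrite in_itv /= l_gt0.
  exact: (cvg_comp f (fun x : R => x `^ q) fl lq).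
move=> l_le0; have {l_le0 l0} l0 : l = 0 by apply/le_anti; rewrite l_le0.
rewrite {l}l0 in fl *; rewrite powR0 ?gt_eqF//.
apply: (@squeeze_cvgr _ _ _ _ (cst 0) f) => //; last exact: cvg_cst.
near=> n; rewrite powR_ge0/=.
have fn1 : f n <= 1 by near: n; apply: (cvgr_le _ fl); exact: ltr01.
have [->|fn0] := eqVneq (f n) 0; first by rewrite powR0 ?gt_eqF.
by apply: ge1r_powR; [rewrite fn1 andbT lt_neqAle eq_sym fn0 f0|exact: ltW].
Unshelve. all: by end_near. Qed.

End powers.

Lemma cvg_sum_ord (R : realType) (N : nat) (f : nat -> nat -> R) (l : nat -> R) :
  (forall i, f n i @[n --> \oo] --> l i) ->
  \sum_(i < N) f n i @[n --> \oo] --> \sum_(i < N) l i.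
Proof.
move=> fl; apply: cvg_big => //; exact: add_continuous.
Qed.

Lemma cvgn_le (R : realType) (f : nat -> R) (l c : R) :
  f @ \oo --> l -> (forall n, f n <= c) -> l <= c.
Proof. by move=> fl fc; apply: (cvgr_to_le fl); near=> n; exact: fc.
Unshelve. all: by end_near. Qed.

Lemma le_sum_ord_widen (R : realType) (u : nat -> R) (M N : nat) : (M <= N)%N ->
  (forall k, 0 <= u k) -> \sum_(k < M) u k <= \sum_(k < N) u k.
Proof.
move=> MN u0; rewrite -(subnKC MN) big_split_ord /= lerDl.
by apply: sumr_ge0.
Qed.

Lemma le_term_sum (R : realType) (u : nat -> R) (j N : nat) : (j < N)%N ->
  (forall k, 0 <= u k) -> u j <= \sum_(k < N) u k.
Proof.
move=> jN u0; apply: le_trans (le_sum_ord_widen jN u0).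
by rewrite big_ord_recr /= lerDr sumr_ge0.
Qed.

Lemma series_tail (R : realType) (u : nat -> R) (C e : R) :
  (forall k, 0 <= u k) -> (forall K, \sum_(k < K) u k <= C) -> 0 < e ->
  exists N, forall K, \sum_(k < K | (N <= k)%N) u k <= e.
Proof.
move=> u0 uC e0; pose A := range (fun K => \sum_(k < K) u k).
have supA : has_sup A.
  by split; [exists (\sum_(k < 0) u k), 0%N|exists C => _ [K _ <-]].
have [_ [N _ <-] Nsup] := sup_adherent e0 supA.
exists N => K.
have SK : \sum_(k < maxn N K) u k <= sup A.
  by apply: ub_le_sup; [exact: supA.2|exists (maxn N K)].
apply: (@le_trans _ _ (\sum_(k < maxn N K | (N <= k)%N) u k)).
  rewrite (big_ord_widen_cond _ (fun k => (N <= k)%N) _ (leq_maxr N K)).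
  rewrite big_mkcond [leRHS]big_mkcond; apply: ler_sum => k _.
  by case: (N <= k)%N => //=; case: (k < K)%N.
have : \sum_(k < maxn N K) u k =
    \sum_(k < N) u k + \sum_(k < maxn N K | (N <= k)%N) u k.
  rewrite (bigID (fun k : 'I_(maxn N K) => (k < N)%N)) /=; congr (_ + _).
    by rewrite (big_ord_widen _ _ (leq_maxl N K)).
  by apply: eq_bigl => k; rewrite -leqNgt.
lra.
Qed.

Lemma sum_ord_supp_le (R : realType) (u : nat -> R) (M K : nat) :
  (forall k, 0 <= u k) -> (forall k, (M <= k)%N -> u k = 0) ->
  \sum_(k < K) u k <= \sum_(k < M) u k.
Proof.
move=> u0 uM; apply: le_trans (le_sum_ord_widen (leq_maxl K M) u0) _.
rewrite (bigID (fun k : 'I__ => (k < M)%N)) /= [X in _ + X]big1 ?addr0; last first.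
  by move=> k; rewrite -leqNgt => /uM.
by rewrite (big_ord_widen _ _ (leq_maxr K M)).
Qed.

Lemma sum_tail_antitone (R : realType) (u : nat -> R) (M N K : nat) :
  (forall k, 0 <= u k) -> (M <= N)%N ->
  \sum_(k < K | (N <= k)%N) u k <= \sum_(k < K | (M <= k)%N) u k.
Proof.
move=> u0 MN; rewrite big_mkcond [leRHS]big_mkcond; apply: ler_sum => k _.
by case: ifPn => [Nk|_]; [rewrite (leq_trans MN Nk)|case: ifP].
Qed.

(** * Contractive nonnegative matrices *)

Section matrices.
Context {R : realType} (q : R).
Hypothesis q_gt1 : 1 < q.
Implicit Types a b c : nat -> nat -> R.
Implicit Types x y : nat -> R.

Let q_gt0 : 0 < q. Proof. exact: lt_trans q_gt1. Qed.
Let qB1_gt0 : 0 < q - 1. Proof. by rewrite subr_gt0. Qed.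

Definition mxapp a (K : nat) x (j : nat) := \sum_(k < K) a j k * x k.

Definition contractive a :=
  (forall j k, 0 <= a j k) /\
  forall J K x, (forall k, 0 <= x k) ->
    \sum_(j < J) mxapp a K x j `^ q <= \sum_(k < K) x k `^ q.

Lemma mxapp_ge0 a K x j : (forall j k, 0 <= a j k) -> (forall k, 0 <= x k) ->
  0 <= mxapp a K x j.
Proof. by move=> a0 x0; apply: sumr_ge0 => k _; rewrite mulr_ge0. Qed.

Lemma contractive_row a j K x : contractive a -> (forall k, 0 <= x k) ->
  \sum_(k < K) x k `^ q <= 1 -> mxapp a K x j <= 1.
Proof.
move=> [a0 ac] x0 x1; apply: (powR_le1 q_gt1); first exact: mxapp_ge0.
apply: le_trans x1; apply: le_trans (ac j.+1 K x x0).
by apply: (@le_term_sum _ (fun j => mxapp a K x j `^ q)) => // k; exact: powR_ge0.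
Qed.

Lemma mxapp_delta a k j : mxapp a k.+1 (fun i => (i == k)%:R) j = a j k.
Proof.
rewrite /mxapp big_ord_recr /= eqxx mulr1 big1 ?add0r// => i _.
by rewrite ltn_eqF// mulr0.
Qed.

Lemma sum_powR_delta k : \sum_(i < k.+1) (i == k :> nat)%:R `^ q = 1 :> R.
Proof.
rewrite big_ord_recr /= eqxx powR1 big1 ?add0r// => i _.
by rewrite ltn_eqF// powR0// gt_eqF.
Qed.

Lemma contractive_col a k J : contractive a -> \sum_(j < J) a j k `^ q <= 1.
Proof.
move=> [a0 ac]; rewrite -(sum_powR_delta k).
have := ac J k.+1 (fun i => (i == k)%:R) (fun i => ler0n _ _).
by under eq_bigr do rewrite mxapp_delta.
Qed.

(** The defining inequalities are closed conditions on the entries. *)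
Lemma contractive_lim (a : nat -> nat -> nat -> R) b :
  (forall m, contractive (a m)) ->
  (forall j k, a m j k @[m --> \oo] --> b j k) -> contractive b.
Proof.
move=> ac ab; split=> [j k|J K x x0].
  by apply: (cvgr_to_ge (ab j k)); near=> m; exact: (ac m).1.
apply: (@cvgn_le _ (fun m => \sum_(j < J) mxapp (a m) K x j `^ q)); last first.
  by move=> m; exact: (ac m).2.
apply: (@cvg_sum_ord _ J (fun m j => mxapp (a m) K x j `^ q)
  (fun j => mxapp b K x j `^ q)) => j.
apply: cvg_powR => // [m|]; first by apply: mxapp_ge0 => //; exact: (ac m).1.
apply: (@cvg_sum_ord _ K (fun m k => a m j k * x k) (fun k => b j k * x k)) => k.
by apply: cvgMl; exact: ab.
Unshelve. all: by end_near. Qed.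

(** Young's inequality, with the weights w and x, bounds the q-th power of the
norm of b v by a convex combination of itself and of that of v. *)
Lemma schur_test b x w :
  (forall j k, 0 <= b j k) -> (forall k, 0 < x k) -> (forall j, 0 < w j) ->
  (forall j K, mxapp b K x j <= w j) ->
  (forall J k, \sum_(j < J) b j k * w j `^ (q - 1) <= x k `^ (q - 1)) ->
  contractive b.
Proof.
move=> b0 x0 w0 bx bw; split=> // J K v v0.
pose V j := mxapp b K v j.
have V0 j : 0 <= V j by exact: mxapp_ge0.
have qV0 : 0 < q^-1 by rewrite invr_gt0.
have qV1 : 0 <= 1 - q^-1 by rewrite subr_ge0 invf_le1// ltW.
have H j k : b j k * (V j `^ (q - 1) * v k) <= b j k * (w j `^ (q - 1) * x k *
    ((1 - q^-1) * (V j / w j) `^ q + q^-1 * (v k / x k) `^ q)).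
  apply: ler_wpM2l => //.
  have -> : V j `^ (q - 1) * v k = w j `^ (q - 1) * x k *
      ((V j / w j) `^ (q - 1) * (v k / x k)).
    rewrite powRM ?invr_ge0 ?(ltW (w0 _))// -[(w j)^-1]powR_inv1 ?(ltW (w0 _))//.
    rewrite [_ `^ (-1) `^ _]powRAC powR_inv1 ?powR_ge0//.
    have : w j `^ (q - 1) != 0 by rewrite gt_eqF// powR_gt0.
    have : x k != 0 by rewrite gt_eqF.
    by move=> xk wj; field; rewrite xk.
  apply: ler_wpM2l; first by rewrite mulr_ge0 ?powR_ge0 ?ltW.
  by apply: young_powRB1 => //; rewrite divr_ge0// ltW.
have S1 : \sum_(j < J) V j `^ q = \sum_(j < J) \sum_(k < K) b j k * (V j `^ (q - 1) * v k).
  apply: eq_bigr => j _; rewrite -(powRB1M q_gt1)//.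
  rewrite {2}/V /mxapp mulr_sumr; apply: eq_bigr => k _; exact: mulrCA.
have S2 : \sum_(j < J) \sum_(k < K) b j k * (w j `^ (q - 1) * x k *
    ((1 - q^-1) * (V j / w j) `^ q + q^-1 * (v k / x k) `^ q)) =
    (1 - q^-1) * (\sum_(j < J) mxapp b K x j * (w j `^ (q - 1) * (V j / w j) `^ q)) +
    q^-1 * \sum_(k < K) (\sum_(j < J) b j k * w j `^ (q - 1)) * (x k * (v k / x k) `^ q).
  under eq_bigr => j _ do (under eq_bigr => k _ do rewrite mulrDr mulrDr; rewrite big_split /=).
  rewrite big_split /=; congr (_ + _).
    rewrite mulr_sumr; apply: eq_bigr => j _.
    rewrite (_ : mxapp b K x j * _ = \sum_(k < K) b j k * x k *
      (w j `^ (q - 1) * (V j / w j) `^ q)); last exact: mulr_suml.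
    by rewrite mulr_sumr; apply: eq_bigr => k _; ring.
  rewrite exchange_big /= mulr_sumr; apply: eq_bigr => k _.
  by rewrite [_ * (x k * _) in RHS]mulr_suml mulr_sumr; apply: eq_bigr => j _; ring.
have T1 : \sum_(j < J) mxapp b K x j * (w j `^ (q - 1) * (V j / w j) `^ q) <=
    \sum_(j < J) V j `^ q.
  apply: ler_sum => j _.
  apply: (@le_trans _ _ (w j * (w j `^ (q - 1) * (V j / w j) `^ q))).
    by apply: ler_wpM2r => //; rewrite mulr_ge0 ?powR_ge0.
  rewrite mulrA mulr_powRB1// ?(ltW (w0 _))// -powRM ?divr_ge0 ?(ltW (w0 _))//.
  by rewrite mulrCA mulfV ?mulr1// gt_eqF.
have T2 : \sum_(k < K) (\sum_(j < J) b j k * w j `^ (q - 1)) * (x k * (v k / x k) `^ q) <=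
    \sum_(k < K) v k `^ q.
  apply: ler_sum => k _.
  apply: (@le_trans _ _ (x k `^ (q - 1) * (x k * (v k / x k) `^ q))).
    by apply: ler_wpM2r => //; rewrite mulr_ge0 ?powR_ge0 ?(ltW (x0 _)).
  rewrite mulrA (powRB1M q_gt1)// ?(ltW (x0 _))// -powRM ?divr_ge0 ?(ltW (x0 _))//.
  by rewrite mulrCA mulfV ?mulr1// gt_eqF.
have : \sum_(j < J) V j `^ q <= (1 - q^-1) * (\sum_(j < J) V j `^ q) +
    q^-1 * \sum_(k < K) v k `^ q.
  rewrite {1}S1; apply: le_trans (lerD (ler_wpM2l qV1 T1) (ler_wpM2l (ltW qV0) T2)).
  by rewrite -S2; apply: ler_sum => j _; apply: ler_sum => k _.
by move=> VV; suff : q^-1 * \sum_(j < J) V j `^ q <= q^-1 * \sum_(k < K) v k `^ q;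
  [rewrite ler_pM2l|lra].
Qed.

(** Testing u against its own power u ^ (p - 1), with p conjugate to q, shows that
the sum of u ^ p converges; its tails then control those of u against the unit
ball through Young's inequality. *)
Lemma row_tail (u : nat -> R) (C e : R) : (forall k, 0 <= u k) ->
  (forall K y, (forall k, 0 <= y k) -> \sum_(k < K) y k `^ q <= 1 ->
    \sum_(k < K) u k * y k <= C) ->
  0 < e ->
  exists N, forall K y, (forall k, 0 <= y k) -> \sum_(k < K) y k `^ q <= 1 ->
    \sum_(k < K | (N <= k)%N) u k * y k <= e.
Proof.
move=> u0 uC e0; pose p := q / (q - 1).
have p0 : 0 < p by rewrite divr_gt0.
have C0 : 0 <= C.
  by have := uC 0%N (fun=> 0) (fun=> lexx _); rewrite !big_ord0; exact.
have pB1 : (p - 1) * q = p by rewrite /p; field; rewrite gt_eqF.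
have Sp K : \sum_(k < K) u k `^ p <= C `^ p.
  set S := \sum_(k < K) _; have S0 : 0 <= S by apply: sumr_ge0 => *; exact: powR_ge0.
  have [->|Sn0] := eqVneq S 0; first exact: powR_ge0.
  have {S0 Sn0} S0 : 0 < S by rewrite lt_neqAle eq_sym Sn0.
  have sgt0 : 0 < S `^ q^-1 by rewrite powR_gt0.
  have /= := uC K (fun k => u k `^ (p - 1) / S `^ q^-1).
  have -> : \sum_(k < K) u k * (u k `^ (p - 1) / S `^ q^-1) = S / S `^ q^-1.
    rewrite mulr_suml; apply: eq_bigr => k _.
    by rewrite mulrA mulr_powRB1.
  have -> : \sum_(k < K) (u k `^ (p - 1) / S `^ q^-1) `^ q = 1.
    transitivity (\sum_(k < K) u k `^ p / S).
      apply: eq_bigr => k _; rewrite powRM ?powR_ge0 ?invr_ge0 ?powR_ge0//.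
      rewrite -powRrM pB1 -[(S `^ _)^-1]powR_inv1 ?(ltW sgt0)//.
      by rewrite powRAC powRVK ?(ltW S0)// powR_inv1// ltW.
    by rewrite -mulr_suml mulfV// gt_eqF.
  move=> /(_ (fun k => divr_ge0 (powR_ge0 _ _) (ltW sgt0)) (lexx _)) SC.
  have Sp : S / S `^ q^-1 = S `^ p^-1.
    have <- : 1 - q^-1 = p^-1 by rewrite /p invf_div; field; rewrite gt_eqF.
    by rewrite powRB ?powRr1 ?(ltW S0)// (gt_eqF S0) implybT.
  rewrite Sp in SC.
  by rewrite -[S](powRVK p0 (ltW S0)); apply: le_powR; rewrite ?powR_ge0// ltW.
(* Young's inequality is applied to u / l and l * y: the second summand gives
   l ^ q = e / 2, and then the tail of u ^ p is taken small enough for l. *)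
pose l := (e / 2) `^ q^-1; have l0 : 0 < l by rewrite powR_gt0// divr_gt0.
have eta0 : 0 < e / 2 * l `^ p by apply: mulr_gt0; [exact: divr_gt0|exact: powR_gt0].
have [N tailN] := series_tail (fun k => powR_ge0 (u k) p) Sp eta0.
exists N => K y y0 y1.
apply: (@le_trans _ _ (\sum_(k < K | (N <= k)%N) ((l `^ p)^-1 * u k `^ p + l `^ q * y k `^ q))).
  apply: ler_sum => k _.
  have -> : u k * y k = (l^-1 * u k) * (l * y k) by field; rewrite gt_eqF.
  have l0V : 0 <= l^-1 by rewrite invr_ge0 ltW.
  have := young_weak q_gt1 (mulr_ge0 l0V (u0 k)) (mulr_ge0 (ltW l0) (y0 k)).
  rewrite -/p !powRM ?(ltW l0)//.
  by rewrite -[l^-1]powR_inv1 ?(ltW l0)// powRAC !powR_inv1 ?powR_ge0// ltW.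
have lq : l `^ q = e / 2 by apply: powRVK => //; rewrite divr_ge0// ltW.
rewrite big_split /= -!mulr_sumr lq.
rewrite [leRHS](_ : e = e / 2 + e / 2); last lra.
apply: lerD.
  by rewrite mulrC ler_pdivrMr; [exact: tailN|exact: powR_gt0].
rewrite ler_piMr ?divr_ge0 ?(ltW e0)//; apply: le_trans y1.
rewrite big_mkcond; apply: ler_sum => k _; case: ifP => // _; exact: powR_ge0.
Qed.

End matrices.

(** * A nonlinear Perron vector *)

Section nonlinear_perron.
Context {R : realType} (q : R).
Hypothesis q_gt1 : 1 < q.
Implicit Types a b c : nat -> nat -> R.
Implicit Types x y u v : nat -> R.

Let q_gt0 : 0 < q. Proof. exact: lt_trans q_gt1. Qed.
Let qB1_gt0 : 0 < q - 1. Proof. by rewrite subr_gt0. Qed.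

(** Multiplying the subsolution inequality by v and summing gives
|v|^q <= t (v_0 + ... ) + |a v + t|^q, where the last term is at most
g |v|^q up to a constant, with g < 1.  The resulting bound does not depend on
t, which is what allows t to be chosen after it. *)
Lemma fixed_vector_bound a (N : nat) (e g t : R) v :
  0 < e -> 0 < t -> t <= 1 -> t <= (1 - g) / 2 -> g < 1 ->
  (forall j k, 0 <= a j k) -> (forall k, 0 <= v k) ->
  (1 + e) `^ q * \sum_(j < N) mxapp a N v j `^ q <= g * \sum_(k < N) v k `^ q ->
  (forall k, (k < N)%N -> v k `^ (q - 1) <=
     t + \sum_(j < N) a j k * (mxapp a N v j + t) `^ (q - 1)) ->
  forall k, (k < N)%N ->
    v k <= 1 + (N%:R + (1 + e^-1) `^ q * N%:R) / ((1 - g) / 2).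
Proof.
move=> e0 t0 t1 tg g1 a0 v0 ag vF k kN.
have av0 j : 0 <= mxapp a N v j by exact: mxapp_ge0.
apply: le_trans (le_powR1D q_gt1 (v0 k)) _; rewrite lerD2l.
apply: le_trans (@le_term_sum _ (fun i => v i `^ q) k N kN (fun=> powR_ge0 _ _)) _.
have -> : \sum_(k < N) v k `^ q = \sum_(k < N) v k `^ (q - 1) * v k.
  by apply: eq_bigr => i _; rewrite (powRB1M q_gt1).
set S := \sum_(k < N) _.
have SE : \sum_(k < N) v k `^ q = S.
  by apply: eq_bigr => i _; rewrite (powRB1M q_gt1).
have H1 : S <= \sum_(k < N) t * v k +
    \sum_(j < N) (mxapp a N v j + t) `^ (q - 1) * mxapp a N v j.
  have -> : \sum_(j < N) (mxapp a N v j + t) `^ (q - 1) * mxapp a N v j =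
      \sum_(i < N) (\sum_(j < N) a j i * (mxapp a N v j + t) `^ (q - 1)) * v i.
    under [RHS]eq_bigr do rewrite mulr_suml.
    rewrite exchange_big /=; apply: eq_bigr => j _.
    by rewrite {2}/mxapp mulr_sumr; apply: eq_bigr => i _; ring.
  rewrite -big_split /=; apply: ler_sum => i _; rewrite -mulrDl.
  by apply: ler_wpM2r => //; exact: vF.
have H2 : \sum_(k < N) t * v k <= t * N%:R + t * S.
  apply: (@le_trans _ _ (\sum_(k < N) (t + t * v k `^ q))).
    apply: ler_sum => i _; rewrite -{2}[t]mulr1 -mulrDr.
    by apply: ler_wpM2l; [exact: ltW|exact: (le_powR1D q_gt1)].
  by rewrite big_split /= sumr_const card_ord -mulr_sumr SE mulr_natr.
have H3 : \sum_(j < N) (mxapp a N v j + t) `^ (q - 1) * mxapp a N v j <=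
    g * S + (1 + e^-1) `^ q * N%:R.
  apply: (@le_trans _ _ (\sum_(j < N) ((1 + e) `^ q * mxapp a N v j `^ q +
      (1 + e^-1) `^ q))); last first.
    by rewrite big_split /= sumr_const card_ord -mulr_sumr mulr_natr lerD2r -SE.
  apply: ler_sum => j _; have yj0 : 0 <= mxapp a N v j + t by rewrite addr_ge0// ltW.
  apply: (@le_trans _ _ ((mxapp a N v j + t) `^ q)).
    rewrite -[leRHS](powRB1M q_gt1)//; apply: ler_wpM2l; first exact: powR_ge0.
    by rewrite lerDl ltW.
  apply: le_trans (powRD_weighted q_gt1 e0 (av0 j) (ltW t0)) _.
  rewrite lerD2l ler_piMr ?powR_ge0//.
  by apply: le_trans (le_powR (ltW q_gt0) (ltW t0) t1) _; rewrite powR1.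
have g2 : 0 < (1 - g) / 2 by rewrite divr_gt0// subr_gt0.
have S0 : 0 <= S by rewrite -SE; apply: sumr_ge0 => i _; exact: powR_ge0.
have N0 : 0 <= N%:R :> R by exact: ler0n.
have tS : t * S <= (1 - g) / 2 * S by exact: ler_wpM2r.
have tN : t * N%:R <= N%:R by rewrite ler_piMl.
rewrite ler_pdivlMr//; lra.
Qed.

(** The right-hand side is monotone in u, so the coordinatewise supremum of all
subsolutions below U is a solution, as in Knaster-Tarski; no continuity is
used.  It is bounded below by t, hence strictly positive. *)
Lemma fixed_vector a (N : nat) (e g : R) :
  0 < e -> g < 1 -> (forall j k, 0 <= a j k) ->
  (forall v, (forall k, 0 <= v k) ->
    (1 + e) `^ q * \sum_(j < N) mxapp a N v j `^ q <= g * \sum_(k < N) v k `^ q) ->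
  exists U : R, 0 <= U /\ forall t, 0 < t -> t <= 1 -> t <= (1 - g) / 2 ->
    exists u, [/\ forall k, 0 <= u k <= U,
      forall k, (k < N)%N -> 0 < u k &
      forall k, (k < N)%N -> u k `^ (q - 1) =
        t + \sum_(j < N) a j k * (mxapp a N u j + t) `^ (q - 1)].
Proof.
move=> e0 g1 a0 ag.
pose U := 1 + (N%:R + (1 + e^-1) `^ q * N%:R) / ((1 - g) / 2).
have g2 : 0 < (1 - g) / 2 by rewrite divr_gt0// subr_gt0.
have U0 : 0 <= U.
  by rewrite addr_ge0// divr_ge0 ?(ltW g2)// addr_ge0// mulr_ge0// powR_ge0.
exists U; split=> // t t0 t1 tg.
pose F v k := t + \sum_(j < N) a j k * (mxapp a N v j + t) `^ (q - 1).
have F0 v k : (forall k, 0 <= v k) -> t <= F v k.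
  by move=> v0; rewrite lerDl; apply: sumr_ge0 => j _; rewrite mulr_ge0 ?powR_ge0.
have Fmono v w k : (forall k, 0 <= v k) -> (forall i, (i < N)%N -> v i <= w i) ->
    F v k <= F w k.
  move=> v0 vw; rewrite lerD2l; apply: ler_sum => j _; apply: ler_wpM2l => //.
  apply: le_powR; first exact: ltW.
    by rewrite addr_ge0 ?mxapp_ge0// ltW.
  by rewrite lerD2r; apply: ler_sum => i _; apply: ler_wpM2l => //; exact: vw.
pose Q : set (nat -> R) := [set v | (forall k, 0 <= v k <= U) /\
  (forall k, (k < N)%N -> v k `^ (q - 1) <= F v k)].
pose u k := sup [set v k | v in Q].
have Q0 : Q (fun=> 0).
  split=> [k|k _]; first by rewrite lexx.
  by rewrite powR0 ?gt_eqF// (le_trans (ltW t0))// F0.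
have supQ k : has_sup [set v k | v in Q].
  split; first by exists 0, (fun=> 0).
  by exists U => _ [v [vU _] <-]; have /andP[] := vU k.
have Qu v k : Q v -> v k <= u k.
  by move=> Qv; apply: ub_le_sup; [exact: (supQ k).2|exists v].
have u0 k : 0 <= u k by exact: (Qu _ k Q0).
have uU k : u k <= U.
  by apply: ge_sup; [exact: (supQ k).1|move=> _ [v [vU _] <-]; have /andP[] := vU k].
have Fu0 k : 0 <= F u k by rewrite (le_trans (ltW t0))// F0.
pose w k := if (k < N)%N then F u k `^ (q - 1)^-1 else 0.
have w0 k : 0 <= w k by rewrite /w; case: ifP => // _; exact: powR_ge0.
have uw k : (k < N)%N -> u k <= w k.
  move=> kN; apply: ge_sup; first exact: (supQ k).1.
  move=> _ [v [vU vF] <-]; have v0 i : 0 <= v i by have /andP[] := vU i.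
  apply: (@powR_le_powR _ (q - 1)) => //.
  rewrite /w kN powRVK//; apply: le_trans (vF _ kN) _.
  by apply: Fmono => // i _; apply: Qu.
have wF k : (k < N)%N -> w k `^ (q - 1) <= F w k.
  by move=> kN; rewrite {1}/w kN powRVK//; apply: Fmono.
have Qw : Q w.
  split=> // k; rewrite w0 /=; have [kN|Nk] := ltnP k N; last first.
    by rewrite /w ltnNge Nk.
  exact: (fixed_vector_bound e0 t0 t1 tg g1 a0 w0 (ag _ w0) wF).
have uE k : (k < N)%N -> u k `^ (q - 1) = F u k.
  move=> kN; have -> : u k = w k by apply/le_anti; rewrite uw//= Qu.
  by rewrite /w kN powRVK.
exists u; split=> // k; first by rewrite u0 uU.
move=> kN; rewrite lt_neqAle u0 andbT; apply/eqP => uk.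
have := F0 u k u0; rewrite -(uE _ kN) -uk powR0 ?gt_eqF//.
by rewrite leNgt t0.
Qed.

End nonlinear_perron.

(** * Norm-attaining matrices and their rigidity *)

Section norming.
Context {R : realType} (q : R).
Hypothesis q_gt1 : 1 < q.
Implicit Types a b c : nat -> nat -> R.
Implicit Types x y u v : nat -> R.

Let q_gt0 : 0 < q. Proof. exact: lt_trans q_gt1. Qed.
Let qB1_gt0 : 0 < q - 1. Proof. by rewrite subr_gt0. Qed.

(** On the first M coordinates, b attains the norm at the strictly positive vector
x, and no coordinate of b x vanishes. *)
Definition norming (M : nat) b x := [/\ forall k, 0 < x k,
  forall j, (j < M)%N -> 0 < mxapp b M x j &
  \sum_(j < M) mxapp b M x j `^ q = \sum_(k < M) x k `^ q].

(** Contractivity of c at x + t y, for y supported beyond M, leaves only t ^ q plus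
the defect of |c x|^q for the first-order growth t (c x)_j ^ (q - 1) (c y)_j.
The number t is chosen first, to make t ^ (q - 1) small against the lower bound
of (c x)_j ^ (q - 1), and then d, to make the defect at most t ^ q. *)
Lemma norming_rigid (M : nat) b x (e : R) : 0 < e -> norming M b x ->
  exists2 d, 0 < d & forall c, contractive q c ->
    (forall j k, (j < M)%N -> (k < M)%N -> `|b j k - c j k| <= d) ->
    forall j K y, (j < M)%N -> (forall k, 0 <= y k) ->
      \sum_(k < K) y k `^ q <= 1 ->
      \sum_(k < K | (M <= k)%N) c j k * y k <= e.
Proof.
move=> e0 [x0 w0 wx]; set w := mxapp b M x in w0 wx.
have [->|Mn0] := eqVneq M 0%N; first by exists 1.
have M0 : (0 < M)%N by rewrite lt0n.
pose W := \sum_(k < M) x k `^ q.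
have W0 : 0 < W.
  apply: (@lt_le_trans _ _ (x 0%N `^ q)); first by rewrite powR_gt0.
  by apply: (@le_term_sum _ (fun k => x k `^ q)) => // k; exact: powR_ge0.
have [m m0 mw] : exists2 m, 0 < m & forall j, (j < M)%N -> m <= w j.
  exists (\big[Num.min/1]_(j < M) w j).
    by apply/bigmin_gtP; split=> // j _; exact: w0.
  by move=> j jM; exact: (bigmin_le _ (Ordinal jM) (fun i : 'I_M => w i)).
pose X := 1 + \sum_(k < M) x k.
have X0 : 0 < X by rewrite ltr_pwDl// sumr_ge0// => k _; exact: ltW.
pose r0 := ((m / 2) `^ (q - 1) * (e / 2)) `^ (q - 1)^-1.
have mm0 : 0 < (m / 2) `^ (q - 1) by rewrite powR_gt0 ?divr_gt0.
have r00 : 0 < r0 by rewrite powR_gt0// mulr_gt0 ?divr_gt0.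
pose t := Num.min r0 ((W / 2) `^ q^-1).
have t0 : 0 < t by rewrite lt_min r00 powR_gt0 ?divr_gt0.
have tW : t `^ q <= W / 2.
  rewrite -[leRHS](@powRVK _ q)//; last by rewrite divr_ge0 ?(ltW W0).
  by apply: le_powR; rewrite ?(ltW q_gt0) ?(ltW t0)// ge_min lexx orbT.
have tq : t `^ (q - 1) <= (m / 2) `^ (q - 1) * (e / 2).
  rewrite -[leRHS](@powRVK _ (q - 1))//; last by rewrite mulr_ge0 ?(ltW mm0)// divr_ge0 ?(ltW e0).
  by apply: le_powR; rewrite ?(ltW qB1_gt0) ?(ltW t0)// ge_min lexx.
(* r is the factor for which r b x has q-th power sum exactly W - t ^ q *)
pose r := (1 - t `^ q / W) `^ q^-1.
have tq0 : 0 < t `^ q by rewrite powR_gt0.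
have tqW : t `^ q / W <= 2^-1 by rewrite ler_pdivrMr// mulrC.
have tqW0 : 0 < t `^ q / W by rewrite divr_gt0.
have rq : r `^ q = 1 - t `^ q / W by apply: powRVK => //; lra.
have r0' : 0 <= r by exact: powR_ge0.
have r1 : r < 1.
  rewrite ltNge; apply/negP => r1.
  have := le_powR (ltW q_gt0) ler01 r1; rewrite powR1 rq; lra.
have r12 : 2^-1 <= r.
  apply: (@powR_le_powR _ q) => //; rewrite rq.
  have : (2^-1 : R) `^ q <= 2^-1 by apply: ge1r_powR; [lra|exact: ltW].
  lra.
exists ((1 - r) * m / X); first by rewrite divr_gt0// mulr_gt0// subr_gt0.
move=> c cc cb j K y jM y0 y1.
have [c0 cK] := cc.
have x0' k : 0 <= x k by exact: ltW.
have cw i : (i < M)%N -> r * w i <= mxapp c M x i.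
  move=> iM; suff : w i - mxapp c M x i <= (1 - r) * w i by lra.
  apply: (@le_trans _ _ ((1 - r) * m)); last by rewrite ler_wpM2l ?mw// subr_ge0 ltW.
  rewrite /w /mxapp -sumrB.
  apply: (@le_trans _ _ (\sum_(k < M) (1 - r) * m / X * x k)).
    apply: ler_sum => k _; rewrite -mulrBl; apply: ler_wpM2r => //.
    by apply: le_trans (cb i k iM _) => //; exact: ler_norm.
  rewrite -mulr_sumr -mulrA ler_piMr ?mulr_ge0 ?subr_ge0 ?(ltW r1) ?(ltW m0)//.
  by rewrite mulrC ler_pdivrMr// mul1r lerDr.
have cw0 i : 0 <= mxapp c M x i by exact: mxapp_ge0.
pose y' k := if (M <= k)%N then y k else 0.
have y'0 k : 0 <= y' k by rewrite /y'; case: ifP.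
have -> : \sum_(k < K | (M <= k)%N) c j k * y k = mxapp c K y' j.
  rewrite big_mkcond; apply: eq_bigr => k _.
  by rewrite /y'; case: ifP => // _; rewrite mulr0.
set s := mxapp c K y' j; have s0 : 0 <= s by exact: mxapp_ge0.
pose L := maxn M K.
pose z k := (if (k < M)%N then x k else 0) + (if (k < K)%N then t * y' k else 0).
have z0 k : 0 <= z k.
  by rewrite addr_ge0//; case: ifP => // _; rewrite mulr_ge0// ltW.
have zx i : mxapp c M x i + t * mxapp c K y' i = mxapp c L z i.
  rewrite /mxapp mulr_sumr (big_ord_widen L (fun k => c i k * x k)) ?leq_maxl//.
  rewrite (big_ord_widen L (fun k => t * (c i k * y' k))) ?leq_maxr//.
  rewrite big_mkcond [X in _ + X]big_mkcond -big_split; apply: eq_bigr => k _ /=.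
  rewrite /z mulrDr; congr (_ + _); case: ifP => // _; rewrite ?mulr0//.
  by rewrite mulrCA.
have zq : \sum_(k < L) z k `^ q <= W + t `^ q.
  apply: (@le_trans _ _ (W + t `^ q * \sum_(k < K) y k `^ q)); last first.
    by rewrite lerD2l ler_piMr// ltW.
  rewrite /W (big_ord_widen L (fun k => x k `^ q)) ?leq_maxl//.
  rewrite (big_ord_widen L (fun k => y k `^ q)) ?leq_maxr//.
  rewrite [X in _ <= X + _]big_mkcond [X in _ + _ * X]big_mkcond mulr_sumr -big_split.
  apply: ler_sum => k _ /=; rewrite /z /y' [(M <= k)%N]leqNgt.
  case: (ltnP k M) => kM /=.
    rewrite !mulr0; have -> : (if (k < K)%N then 0 else 0) = 0 :> R by case: ifP.
    by rewrite addr0 lerDl mulr_ge0 ?powR_ge0//; case: ifP => // _; exact: powR_ge0.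
  rewrite !add0r; case: ifP => _; last by rewrite powR0 ?gt_eqF// mulr0.
  by rewrite powRM// ltW.
have H : r `^ q * W + t * (s * (m / 2) `^ (q - 1)) <= W + t `^ q.
  apply: le_trans zq; apply: le_trans (cK M L z z0).
  apply: (@le_trans _ _ (\sum_(i < M) (mxapp c M x i + t * mxapp c K y' i) `^ q)); last first.
    by apply: ler_sum => i _; rewrite zx.
  apply: (@le_trans _ _ (\sum_(i < M) (mxapp c M x i `^ q +
      mxapp c M x i `^ (q - 1) * (t * mxapp c K y' i)))); last first.
    apply: ler_sum => i _; apply: (powRD_ge q_gt1) => //.
    by rewrite mulr_ge0 ?(ltW t0)// mxapp_ge0.
  rewrite big_split /=; apply: lerD.
    rewrite /W -wx mulr_sumr; apply: ler_sum => i _.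
    by rewrite -powRM ?(ltW (w0 _ _))//; apply: le_powR; rewrite ?(ltW q_gt0) ?cw ?mulr_ge0 ?(ltW (w0 _ _)).
  apply: (@le_trans _ _ (mxapp c M x j `^ (q - 1) * (t * s))); last first.
    apply: (@le_term_sum _ (fun i => mxapp c M x i `^ (q - 1) * (t * mxapp c K y' i))) => // i.
    by rewrite mulr_ge0 ?powR_ge0// mulr_ge0 ?(ltW t0)// mxapp_ge0.
  rewrite [s * _]mulrC mulrCA; apply: ler_wpM2r; first by rewrite mulr_ge0// ltW.
  apply: le_powR; [exact: ltW|by rewrite divr_ge0// ltW|].
  apply: le_trans (cw _ jM); rewrite mulrC; apply: ler_pM => //.
  - exact: ltW.
  - exact: mw.
have {H} H : t * (s * (m / 2) `^ (q - 1)) <= t * (2 * t `^ (q - 1)).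
  have -> : t * (2 * t `^ (q - 1)) = 2 * t `^ q by rewrite mulrCA mulr_powRB1// ltW.
  have : r `^ q * W = W - t `^ q by rewrite rq mulrBl mul1r mulfVK// gt_eqF.
  lra.
rewrite ler_pM2l// in H.
rewrite -(ler_pM2r mm0); apply: le_trans H _; lra.
Qed.

(** With u the Perron vector for the parameter t, y = a u + t and x = (u, 1), the
matrix b is obtained from a by adding a column t, a constant row and a corner
entry.  The row t / z ^ (q - 1) supplies the term t of the Perron equation, and z and the
corner are then forced by the last coordinates of b x = (y, z) and
b^T (y, z) ^ (q - 1) = x ^ (q - 1). *)
Lemma norming_extension a (N : nat) (e g d : R) :
  0 < e -> g < 1 -> 0 < d -> (forall j k, 0 <= a j k) ->
  (forall v, (forall k, 0 <= v k) ->
    (1 + e) `^ q * \sum_(j < N) mxapp a N v j `^ q <= g * \sum_(k < N) v k `^ q) ->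
  exists b x, [/\ contractive q b, norming N.+1 b x,
    forall j k, (j < N)%N -> (k < N)%N -> b j k = a j k,
    forall i, i != N -> b i N <= d /\ b N i <= d &
    forall j k, (N < maxn j k)%N -> b j k = 0].
Proof.
move=> e0 g1 d0 a0 ag.
have g2 : 0 < (1 - g) / 2 by rewrite divr_gt0// subr_gt0.
have [U [U0 fixU]] := fixed_vector q_gt1 e0 g1 a0 ag.
pose Y := (\sum_(j < N) \sum_(k < N) a j k) * U + 1.
have SA0 : 0 <= \sum_(j < N) \sum_(k < N) a j k.
  by apply: sumr_ge0 => j _; apply: sumr_ge0.
have Y0 : 0 < Y by rewrite ltr_wpDl// mulr_ge0.
(* Y bounds the coordinates of y, t <= 1 / D keeps the corner nonnegative and z
   at least 1/2, and t <= d * h makes the new row at most d. *)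
pose D := 2 * (1 + N%:R * Y `^ (q - 1)).
have D0 : 0 < D by rewrite mulr_gt0// ltr_pwDl// mulr_ge0 ?powR_ge0.
pose h := (2^-1 : R) `^ (q - 1).
have h0 : 0 < h by rewrite powR_gt0.
pose t := Num.min (Num.min 1 ((1 - g) / 2)) (Num.min (Num.min d (d * h)) D^-1).
have t0 : 0 < t by rewrite !lt_min ltr01 g2 d0 mulr_gt0//= invr_gt0.
have [t1 tg td tdh tD] : [/\ t <= 1, t <= (1 - g) / 2, t <= d, t <= d * h & t <= D^-1].
  by split; rewrite !ge_min lexx ?orbT.
have [u [uU u_gt0 uE]] := fixU t t0 t1 tg.
have u0 k : 0 <= u k by have /andP[] := uU k.
pose y j := mxapp a N u j + t.
have y0 j : 0 < y j by rewrite ltr_wpDl// mxapp_ge0.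
have yY j : (j < N)%N -> y j <= Y.
  move=> jN; apply: lerD => //; rewrite mulr_suml.
  apply: (@le_trans _ _ ((\sum_(k < N) a j k) * U)).
    rewrite mulr_suml; apply: ler_sum => k _; apply: ler_wpM2l => //.
    by have /andP[] := uU k.
  apply: (@le_term_sum _ (fun j => (\sum_(k < N) a j k) * U)) => // i.
  by rewrite mulr_ge0// sumr_ge0.
pose s1 := \sum_(k < N) u k; pose s2 := \sum_(j < N) y j `^ (q - 1).
have s10 : 0 <= s1 by apply: sumr_ge0.
have s20 : 0 <= s2 by apply: sumr_ge0 => j _; exact: powR_ge0.
have ts2 : t * s2 <= 2^-1.
  have s2D : s2 <= D / 2.
    rewrite /D mulrAC mulfV// mul1r; apply: (@le_trans _ _ (\sum_(j < N) Y `^ (q - 1))).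
      by apply: ler_sum => j _; apply: le_powR; rewrite ?(ltW qB1_gt0) ?(ltW (y0 _)) ?yY.
    by rewrite sumr_const card_ord mulr_natl lerDr.
  apply: (@le_trans _ _ (D^-1 * (D / 2))).
    by apply: ler_pM => //; exact: ltW.
  by rewrite mulrA mulVf ?mul1r// gt_eqF.
have ts20 : 0 <= t * s2 by rewrite mulr_ge0// ltW.
have ts10 : 0 <= t * s1 by rewrite mulr_ge0// ltW.
pose z := (1 + t * s1 - t * s2) `^ q^-1.
have zq : z `^ q = 1 + t * s1 - t * s2 by apply: powRVK => //; lra.
have z12 : 2^-1 <= z.
  apply: (@powR_le_powR _ q); rewrite ?powR_ge0//.
  have : (2^-1 : R) `^ q <= 2^-1 by apply: ge1r_powR; [lra|exact: ltW].
  rewrite zq; lra.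
have z0 : 0 < z by lra.
have zB0 : 0 < z `^ (q - 1) by rewrite powR_gt0.
have zBn0 : z `^ (q - 1) != 0 by rewrite gt_eqF.
have hz : h <= z `^ (q - 1) by apply: le_powR; rewrite ?(ltW qB1_gt0).
pose b j k :=
  if (j < N)%N then (if (k < N)%N then a j k else (if k == N then t else 0))
  else if j == N then
    (if (k < N)%N then t / z `^ (q - 1)
     else if k == N then (1 - t * s2) / z `^ (q - 1) else 0)
  else 0.
pose x k := if (k < N)%N then u k else 1.
pose w j := if (j < N)%N then y j else if j == N then z else 1.
have b0 j k : 0 <= b j k.
  rewrite /b; do ![case: ifP => // _]; rewrite ?(ltW t0)//.
    by rewrite divr_ge0 ?ltW.
  by rewrite divr_ge0 ?(ltW zB0)//; lra.
have bN j k : (N < maxn j k)%N -> b j k = 0.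
  rewrite leq_max /b => /orP[jN|kN].
    by rewrite ltnNge (ltnW jN)/= gtn_eqF.
  by rewrite [(k < N)%N]ltnNge (ltnW kN)/= (gtn_eqF kN) !if_same.
have x0 k : 0 < x k by rewrite /x; case: ifP => // kN; exact: u_gt0.
have w0 j : 0 < w j by rewrite /w; do 2![case: ifP => // _].
have bx j : (j < N.+1)%N -> mxapp b N.+1 x j = w j.
  rewrite ltnS leq_eqVlt /mxapp big_ord_recr /= => /orP[/eqP ->|jN].
    rewrite /b /x /w ltnn eqxx mulr1.
    under eq_bigr => k _ do rewrite ltn_ord.
    rewrite -mulr_sumr -/s1.
    apply: (mulIf zBn0); rewrite mulr_powRB1 ?(ltW z0)// zq; field.
    exact: zBn0.
  rewrite /b /x /w ltnn eqxx jN mulr1 /y; congr (_ + _).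
  by apply: eq_bigr => k _; rewrite ltn_ord.
have bw k : (k < N.+1)%N -> \sum_(j < N.+1) b j k * w j `^ (q - 1) = x k `^ (q - 1).
  rewrite ltnS leq_eqVlt big_ord_recr /= => /orP[/eqP ->|kN].
    rewrite /b /x /w ltnn eqxx mulfVK// powR1.
    under eq_bigr => j _ do rewrite ltn_ord.
    by rewrite -mulr_sumr -/s2 addrC subrK.
  rewrite /b /x /w ltnn eqxx kN mulfVK// uE// addrC; congr (_ + _).
  by apply: eq_bigr => j _; rewrite ltn_ord.
exists b, x; split => //.
- apply: (schur_test q_gt1 b0 x0 w0) => [j K|J k].
    have [jN|Nj] := ltnP j N.+1.
      rewrite -(bx _ jN); apply: (@sum_ord_supp_le _ (fun k => b j k * x k)) => k.
        by rewrite mulr_ge0// ltW.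
      by move=> Nk; rewrite bN ?mul0r// leq_max Nk orbT.
    rewrite /mxapp big1 ?(ltW (w0 _))// => k _.
    by rewrite bN ?mul0r// leq_max Nj.
  have [kN|Nk] := ltnP k N.+1.
    rewrite -(bw _ kN); apply: (@sum_ord_supp_le _ (fun j => b j k * w j `^ (q - 1))) => j.
      by rewrite mulr_ge0// powR_ge0.
    by move=> Nj; rewrite bN ?mul0r// leq_max Nj.
  rewrite big1 ?powR_ge0// => j _.
  by rewrite bN ?mul0r// leq_max Nk orbT.
- split=> // [j jN|]; first by rewrite bx.
  transitivity (\sum_(j < N.+1) \sum_(k < N.+1) b j k * x k * w j `^ (q - 1)).
    apply: eq_bigr => j _; rewrite bx// -mulr_powRB1 ?(ltW (w0 _))//.
    by rewrite -{1}(bx j)// /mxapp mulr_suml.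
  rewrite exchange_big /=; apply: eq_bigr => k _.
  rewrite -[RHS]mulr_powRB1 ?(ltW (x0 _))// -(bw k)// mulr_sumr.
  by apply: eq_bigr => j _; ring.
- by move=> j k jN kN; rewrite /b jN kN.
- move=> i iN; rewrite /b ltnn eqxx (negbTE iN); split; case: ifP => // _; try exact: ltW.
  by rewrite ler_pdivrMr//; apply: le_trans tdh _; rewrite ler_pM2l.
Qed.

End norming.

(** * Approximation by norm-attaining matrices *)

Section approximation.
Context {R : realType} (q : R).
Hypothesis q_gt1 : 1 < q.
Implicit Types a b c : nat -> nat -> R.
Implicit Types x y u v : nat -> R.

Let q_gt0 : 0 < q. Proof. exact: lt_trans q_gt1. Qed.

(** No q-th root is taken: only the smallness of e matters, and the finite
inequalities are about sums of q-th powers. *)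
Definition col_near (n : nat) (e : R) a b := forall k J, (k < n)%N ->
  \sum_(j < J) `|a j k - b j k| `^ q <= e.

(** The dual norm of the difference of rows, expressed by testing on the
nonnegative part of the unit ball, so that no conjugate exponent appears. *)
Definition row_near (n : nat) (e : R) a b := forall j K y, (j < n)%N ->
  (forall k, 0 <= y k) -> \sum_(k < K) y k `^ q <= 1 ->
  \sum_(k < K) `|a j k - b j k| * y k <= e.

Lemma col_nearD n (e1 e2 : R) a b c :
  col_near n e1 a b -> col_near n e2 b c -> col_near n (2 `^ q * (e1 + e2)) a c.
Proof.
move=> ab bc k J kn.
apply: le_trans (ler_wpM2l (powR_ge0 _ _) (lerD (ab k J kn) (bc k J kn))).
rewrite -big_split mulr_sumr; apply: ler_sum => j _ /=.
apply: le_trans (powRD_le2 q_gt1 (normr_ge0 _) (normr_ge0 _)).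
apply: le_powR => //; first exact: ltW.
have -> : a j k - c j k = (a j k - b j k) + (b j k - c j k) by ring.
exact: ler_normD.
Qed.

Lemma row_nearD n (e1 e2 : R) a b c :
  row_near n e1 a b -> row_near n e2 b c -> row_near n (e1 + e2) a c.
Proof.
move=> ab bc j K y jn y0 y1.
apply: le_trans (lerD (ab j K y jn y0 y1) (bc j K y jn y0 y1)).
rewrite -big_split; apply: ler_sum => k _ /=; rewrite -mulrDl; apply: ler_wpM2r => //.
have -> : a j k - c j k = (a j k - b j k) + (b j k - c j k) by ring.
exact: ler_normD.
Qed.

Lemma coord_le1 K y k : (forall k, 0 <= y k) -> \sum_(k < K) y k `^ q <= 1 ->
  (k < K)%N -> y k <= 1.
Proof.
move=> y0 y1 kK; apply: (powR_le1 q_gt1) => //; apply: le_trans y1.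
by apply: (@le_term_sum _ (fun k => y k `^ q)) => // i; exact: powR_ge0.
Qed.

Lemma uniform_tails a n (e : R) : contractive q a -> 0 < e ->
  exists N, [/\ (n <= N)%N,
    forall k J, (k < n)%N -> \sum_(j < J | (N <= j)%N) a j k `^ q <= e &
    forall j K y, (j < n)%N -> (forall k, 0 <= y k) ->
      \sum_(k < K) y k `^ q <= 1 -> \sum_(k < K | (N <= k)%N) a j k * y k <= e].
Proof.
move=> ac e0; have a0 := ac.1.
have /choice[Nc NcP] : forall k, exists N, forall J,
    \sum_(j < J | (N <= j)%N) a j k `^ q <= e.
  move=> k; apply: (@series_tail _ (fun j => a j k `^ q) 1) => // [j|J].
    exact: powR_ge0.
  exact: contractive_col.
have /choice[Nr NrP] : forall j, exists N, forall K y, (forall k, 0 <= y k) ->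
    \sum_(k < K) y k `^ q <= 1 -> \sum_(k < K | (N <= k)%N) a j k * y k <= e.
  move=> j; apply: (@row_tail _ q q_gt1 (a j) 1) => // K y y0 y1.
  exact: (contractive_row q_gt1 j ac y0 y1).
pose N := (n + \max_(i < n) maxn (Nc i) (Nr i))%N.
have NN i : (i < n)%N -> (Nc i <= N)%N && (Nr i <= N)%N.
  move=> ni; rewrite -geq_max (leq_trans _ (leq_addl _ _))//.
  exact: (@leq_bigmax _ (fun i : 'I_n => maxn (Nc i) (Nr i)) (Ordinal ni)).
exists N; split; first exact: leq_addr.
  move=> k J /NN/andP[kN _]; apply: le_trans (NcP k J).
  by apply: (@sum_tail_antitone _ (fun j => a j k `^ q)) => // j; exact: powR_ge0.
move=> j K y /NN/andP[_ jN] y0 y1; apply: le_trans (NrP j K y y0 y1).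
by apply: (@sum_tail_antitone _ (fun k => a j k * y k)) => // k; exact: mulr_ge0.
Qed.

(** Shrinking by (1 + s)^-2 leaves room for the factor (1 + s) ^ q required by the
Perron vector: half of the shrinking pays for it, the other half gives g. *)
Lemma truncation a n (e : R) : contractive q a -> 0 < e ->
  exists N (s g : R) b, [/\ (n <= N)%N, 0 < s /\ g < 1,
    (forall j k, 0 <= b j k) /\
      (forall j k, (N <= maxn j k)%N -> b j k = 0),
    forall v, (forall k, 0 <= v k) ->
      (1 + s) `^ q * \sum_(j < N) mxapp b N v j `^ q <= g * \sum_(k < N) v k `^ q &
    col_near n e a b /\ row_near n e a b].
Proof.
move=> ac e0; have a0 := ac.1.
have e20 : 0 < e / 2 by rewrite divr_gt0.
have [N [nN cN rN]] := uniform_tails n ac e20.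
pose s := e / 4; have s0 : 0 < s by rewrite divr_gt0.
have s1 : 0 < 1 + s by lra.
pose t := (1 + s)^-1; have t0 : 0 < t by rewrite invr_gt0.
have t1 : t < 1 by rewrite invf_lt1//; lra.
have ts : t * (1 + s) = 1 by rewrite mulVf// gt_eqF.
have tt : 1 - t * t <= e / 2.
  have st : s * t <= s by rewrite ler_piMr// ltW.
  have : 1 - t <= s by lra.
  have : t * (1 - t) <= 1 - t by rewrite ler_piMl ?(ltW t1)// subr_ge0 ltW.
  rewrite /s; lra.
have tt0 : 0 <= t * t by rewrite mulr_ge0// ltW.
have tt1 : t * t <= 1 by rewrite mulr_ile1// ltW.
pose b j k := if (maxn j k < N)%N then t * t * a j k else 0.
have b0 j k : 0 <= b j k by rewrite /b; case: ifP => // _; rewrite mulr_ge0.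
have ab j k : `|a j k - b j k| <=
    (e / 2) * a j k + (if (N <= maxn j k)%N then a j k else 0).
  rewrite /b ltnNge; case: (N <= maxn j k)%N => /=.
    by rewrite subr0 ger0_norm// lerDr mulr_ge0// ltW.
  rewrite -{1}[a j k]mul1r -mulrBl addr0 ger0_norm; first exact: ler_wpM2r.
  by rewrite mulr_ge0// subr_ge0.
exists N, s, (t `^ q), b; split => //.
- split=> //; have := gt0_ltr_powR q_gt0 _ _ t1.
  by rewrite powR1; apply; rewrite nnegrE// ltW.
- by split=> // j k; rewrite /b ltnNge => ->.
- move=> v v0; have -> : t `^ q = (1 + s) `^ q * (t * t) `^ q.
    by rewrite -powRM ?(ltW s1)// mulrCA [_ * t]mulrC ts mulr1.
  rewrite -mulrA; apply: ler_wpM2l; first exact: powR_ge0.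
  apply: le_trans (ler_wpM2l (powR_ge0 _ _) (ac.2 N N v v0)).
  rewrite mulr_sumr; apply: ler_sum => j _; rewrite -powRM ?mxapp_ge0//.
  apply: le_powR; rewrite ?(ltW q_gt0) ?mxapp_ge0//.
  rewrite /mxapp mulr_sumr; apply: ler_sum => k _; rewrite mulrA.
  by apply: ler_wpM2r => //; rewrite /b gtn_max !ltn_ord.
- have tt20 : 0 <= 1 - t * t by rewrite subr_ge0.
  split=> [k J kn|j K y jn y0 y1].
    have kN : (k < N)%N := leq_trans kn nN.
    apply: (@le_trans _ _ (\sum_(j < J) ((e / 2) * a j k `^ q +
        (if (N <= j)%N then a j k `^ q else 0)))).
      apply: ler_sum => j _; rewrite /b gtn_max kN andbT ltnNge.
      case: (N <= j)%N => /=.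
        by rewrite subr0 ger0_norm// lerDr mulr_ge0 ?powR_ge0// ltW.
      rewrite addr0 -{1}[a j k]mul1r -mulrBl ger0_norm ?mulr_ge0// powRM//.
      apply: ler_wpM2r; first exact: powR_ge0.
      apply: le_trans tt; have [->|tn] := eqVneq (1 - t * t) 0; first by rewrite powR0// gt_eqF.
      apply: ge1r_powR; last exact: ltW.
      by rewrite lt_neqAle eq_sym tn tt20/= gerBl.
    rewrite big_split /= -mulr_sumr -big_mkcond /= [leRHS](_ : e = e / 2 + e / 2); last lra.
    apply: lerD; last exact: cN.
    by rewrite ler_piMr ?(ltW e20)//; exact: contractive_col.
  have jN : (j < N)%N := leq_trans jn nN.
  apply: (@le_trans _ _ (\sum_(k < K) ((e / 2) * (a j k * y k) +
      (if (N <= k)%N then a j k * y k else 0)))).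
    apply: ler_sum => k _.
    apply: (@le_trans _ _ (((e / 2) * a j k + (if (N <= maxn j k)%N then a j k else 0)) * y k)).
      by apply: ler_wpM2r.
    rewrite leq_max [(N <= j)%N]leqNgt jN /= mulrDl mulrA.
    by case: ifP => // _; rewrite mul0r.
  rewrite big_split /= -mulr_sumr -big_mkcond /= [leRHS](_ : e = e / 2 + e / 2); last lra.
  apply: lerD; last exact: rN.
  by rewrite ler_piMr ?(ltW e20)//; exact: (contractive_row q_gt1 j ac y0 y1).
Qed.

(** In the first N columns and rows, a bordered matrix differs from the original
one by a single entry. *)
Lemma extension_near (N : nat) (d : R) a b : 0 < d -> d <= 1 ->
  (forall j k, 0 <= b j k) ->
  (forall j k, (N <= maxn j k)%N -> a j k = 0) ->
  (forall j k, (j < N)%N -> (k < N)%N -> b j k = a j k) ->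
  (forall i, i != N -> b i N <= d /\ b N i <= d) ->
  (forall j k, (N < maxn j k)%N -> b j k = 0) ->
  col_near N d a b /\ row_near N d a b.
Proof.
move=> d0 d1 b0 a0 ba bN bN0.
have ab0 j k : (j < N)%N || (k < N)%N -> `|a j k - b j k| =
    if (j == N) || (k == N) then b j k else 0.
  move=> jk; have [jN|jN] /= := eqVneq j N.
    by rewrite a0 ?jN ?leq_maxl// sub0r normrN ger0_norm.
  have [kN|kN] /= := eqVneq k N.
    by rewrite a0 ?kN ?leq_maxr// sub0r normrN ger0_norm.
  have [mN|Nm] := ltnP N (maxn j k); first by rewrite a0 1?ltnW// bN0// subrr normr0.
  have : (maxn j k < N)%N by rewrite ltn_neqAle Nm andbT /maxn; case: ifP.
  by rewrite gtn_max => /andP[jN' kN']; rewrite ba// subrr normr0.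
split=> [k J kN|j K y jN y0 y1].
  apply: (@le_trans _ _ (\sum_(j < N.+1) `|a j k - b j k| `^ q)).
    apply: (@sum_ord_supp_le _ (fun j => `|a j k - b j k| `^ q)) => j.
      exact: powR_ge0.
    move=> Nj; rewrite ab0 ?kN ?orbT// gtn_eqF// ltn_eqF//=.
    by rewrite powR0 ?gt_eqF.
  rewrite big_ord_recr /= big1 ?add0r => [|j _]; last first.
    by rewrite ab0 ?kN ?orbT// !ltn_eqF//= powR0// gt_eqF.
  rewrite ab0 ?kN ?orbT// eqxx /=.
  have [_ bd] := bN _ (negbT (ltn_eqF kN)).
  apply: le_trans (le_powR (ltW q_gt0) (b0 _ _) _) _.
  exact: bd.
  by apply: ge1r_powR; [rewrite d0|exact: ltW].
apply: (@le_trans _ _ (\sum_(k < N.+1) `|a j k - b j k| * (if (k < K)%N then y k else 0))).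
  rewrite [leLHS](_ : _ = \sum_(k < K) `|a j k - b j k| * (if (k < K)%N then y k else 0)); last first.
    by apply: eq_bigr => k _; rewrite ltn_ord.
  apply: (@sum_ord_supp_le _ (fun k => `|a j k - b j k| * (if (k < K)%N then y k else 0))) => k.
    by rewrite mulr_ge0//; case: ifP.
  by move=> Nk; rewrite ab0 ?jN// ltn_eqF// gtn_eqF//= mul0r.
rewrite big_ord_recr /= big1 ?add0r => [|k _]; last first.
  by rewrite ab0 ?jN// !ltn_eqF//= mul0r.
rewrite ab0 ?jN// eqxx orbT.
have [bd _] := bN _ (negbT (ltn_eqF jN)).
case: ifP => [NK|_]; last by rewrite mulr0 ltW.
by apply: le_trans bd; rewrite ler_piMr//; exact: (coord_le1 y0 y1).
Qed.

(** Proximity of columns alone, to a suitable b, gives proximity of both columns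
and rows to a.  In a row of c the entries of index at most N are close to those
of b because there are finitely many of them, and the remaining ones are small
by rigidity. *)
Lemma col_near_controls_row_near a n (e : R) : contractive q a -> 0 < e ->
  exists b m d, [/\ contractive q b, 0 < d &
    forall c, contractive q c -> col_near m d b c ->
      col_near n e a c /\ row_near n e a c].
Proof.
move=> ac e0.
pose B : R := 2 `^ q; have B1 : 1 <= B.
  have := @le_powR _ q 1 2 (ltW q_gt0); rewrite powR1; apply; lra.
pose d := Num.min 1 (e / (8 * B * B)).
have B0 : 0 < B by lra.
have d0 : 0 < d by rewrite lt_min ltr01 divr_gt0// !mulr_gt0.
have d1 : d <= 1 by rewrite ge_min lexx.
have dB : d * (8 * B * B) <= e by rewrite -ler_pdivlMr ?mulr_gt0// ge_min lexx orbT.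
have [N [s [g [a' [nN [s0 g1] [a'0 a'N] a'g [ca ra]]]]]] := truncation n ac d0.
have [b [x [bc bx ba bN bN0]]] := norming_extension q_gt1 s0 g1 d0 a'0 a'g.
have [cb rb] := extension_near d0 d1 bc.1 a'N ba bN bN0.
have [h h0 hP] := norming_rigid q_gt1 d0 bx.
pose M := N.+1.
pose h' := Num.min h (d / M%:R).
have M0 : 0 < M%:R :> R by rewrite ltr0n.
have h'0 : 0 < h' by rewrite lt_min h0 divr_gt0.
exists b, M, (Num.min d (h' `^ q)); split=> //.
  by rewrite lt_min d0 powR_gt0.
move=> c cc bcn.
have cn (e' : R) a1 a2 : col_near N e' a1 a2 -> col_near n e' a1 a2.
  by move=> H k J kn; apply: H; exact: leq_trans nN.
have rn (e' : R) a1 a2 : row_near N e' a1 a2 -> row_near n e' a1 a2.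
  by move=> H j K y jn; apply: H; exact: leq_trans nN.
have bch j k : (j < M)%N -> (k < M)%N -> `|b j k - c j k| <= h'.
  move=> _ kM; apply: (@powR_le_powR _ q) => //; first exact: ltW.
  apply: le_trans (@le_term_sum _ (fun j => `|b j k - c j k| `^ q) j j.+1 _ _) _ => //.
  by apply: le_trans (bcn k j.+1 kM) _; rewrite ge_min lexx orbT.
split.
  have H3 : col_near n d b c.
    move=> k J kn; apply: le_trans (bcn k J _) _; last by rewrite ge_min lexx.
    by rewrite ltnS ltnW// (leq_trans kn).
  have := col_nearD (col_nearD ca (cn _ _ _ cb)) H3.
  move=> H k J kn; apply: le_trans (H k J kn) _; rewrite -/B.
  apply: le_trans dB; have Bd : d <= B * d by rewrite ler_peMl// ltW.
  have BBd : B * d <= B * (B * d) by rewrite ler_wpM2l// ltW.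
  have := ler_wpM2l (ltW d0) B1; nra.
have H3 : row_near n (2 * d) b c.
  move=> j K y jn y0 y1; have jM : (j < M)%N by rewrite ltnS ltnW// (leq_trans jn).
  rewrite (bigID (fun k : 'I_K => (M <= k)%N)) /= mulrDl mul1r; apply: lerD.
    apply: le_trans (hP c cc _ j K y jM y0 y1) => [|i k iM kM].
      apply: ler_sum => k Mk; rewrite bN0 ?leq_max ?Mk ?orbT//.
      by rewrite sub0r normrN ger0_norm ?cc.1.
    by rewrite (le_trans (bch _ _ iM kM))// ge_min lexx.
  apply: (@le_trans _ _ (\sum_(k < M) h')); last first.
    rewrite sumr_const card_ord -mulr_natr -ler_pdivlMr//.
    by rewrite ge_min lexx orbT.
  apply: (@le_trans _ _ (\sum_(k < K | (k < M)%N) h')).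
    rewrite [leLHS](_ : _ = \sum_(k < K | (k < M)%N) `|b j k - c j k| * y k); last first.
      by apply: eq_bigl => k; rewrite -ltnNge.
    apply: ler_sum => k kM; apply: (@le_trans _ _ (h' * 1)); last by rewrite mulr1.
    by apply: ler_pM => //; [exact: bch|exact: (coord_le1 y0 y1)].
  rewrite big_mkcond; apply: le_trans (@sum_ord_supp_le _
    (fun k => if (k < M)%N then h' else 0) M K _ _) _ => [k|k Mk|].
  - by case: ifP => // _; exact: ltW.
  - by rewrite ltnNge Mk.
  - by apply: ler_sum => k _; rewrite ltn_ord.
have := row_nearD (row_nearD ra (rn _ _ _ rb)) H3.
move=> H j K y jn y0 y1; apply: le_trans (H j K y jn y0 y1) _.
apply: le_trans dB; have : 1 <= B * B by nra.
nra.
Qed.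

End approximation.

(** * The sequence space and its truncations *)

Section sequence_space.
Local Open Scope complex_scope.
Context {R : realType} {q : R} {q1 : 1 <= q}.
Hypothesis q_gt1 : 1 < q.
Local Notation X := (lq q1).
Implicit Types x y : X.

Let q_gt0 : 0 < q. Proof. exact: lt_trans q_gt1. Qed.

Lemma Rnorm_normc (z : R[i]^o) : Rnorm z = ComplexField.Normc.normc z.
Proof. by []. Qed.

Lemma lq_norm_fin x :
  (\sum_(n <oo) (Rnorm (x n) `^ q)%:E = (Rnorm x `^ q)%:E)%E.
Proof.
have S0 : (0 <= \sum_(n <oo) (Rnorm (x n) `^ q)%:E)%E.
  by apply: nneseries_ge0 => n *; rewrite lee_fin powR_ge0.
have : (Rnorm x)%:E = lq_enorm q x by exact: lq_normK.
rewrite (lq_enormE q1).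
case: (\sum_(n <oo) _)%E S0 => [s| |]//=; rewrite ?lee_fin => s0.
  by move=> -[->]; rewrite powRVK.
by rewrite gt_eqF// invr_gt0.
Qed.

Lemma lq_partial_sum_le x J : \sum_(j < J) Rnorm (x j) `^ q <= Rnorm x `^ q.
Proof.
rewrite -lee_fin -lq_norm_fin -sumEFin.
have := @nneseries_lim_ge R (fun n => (Rnorm (x n) `^ q)%:E) xpredT 0 J.
by rewrite big_mkord; apply => n *; rewrite lee_fin powR_ge0.
Qed.

Lemma series_le_partial_sums (s : nat -> R[i]^o) (C : R) :
  (forall J, \sum_(j < J) Rnorm (s j) `^ q <= C) ->
  (\sum_(n <oo) (Rnorm (s n) `^ q)%:E <= C%:E)%E.
Proof.
move=> sC; apply: lime_le.
  by apply: is_cvg_nneseries => n *; rewrite lee_fin powR_ge0.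
by near=> n; rewrite /= big_mkord sumEFin lee_fin.
Unshelve. all: by end_near. Qed.

Lemma lq_norm_le x (C : R) : 0 <= C ->
  (forall J, \sum_(j < J) Rnorm (x j) `^ q <= C `^ q) -> Rnorm x <= C.
Proof.
move=> C0 /series_le_partial_sums; rewrite lq_norm_fin lee_fin.
by apply: powR_le_powR => //; exact: Rnorm_ge0.
Qed.

Lemma lq_mem (s : nat -> R[i]^o) (C : R) :
  (forall J, \sum_(j < J) Rnorm (s j) `^ q <= C) -> s \in lq_pred q1.
Proof.
move=> /series_le_partial_sums sC; rewrite unfold_in (lq_enormE q1).
have : (0 <= \sum_(n <oo) (Rnorm (s n) `^ q)%:E)%E.
  by apply: nneseries_ge0 => n *; rewrite lee_fin powR_ge0.
case: (\sum_(n <oo) _)%E sC => [r _ _| |]//; first by rewrite poweR_EFin ltry.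
Qed.

Lemma lq_coord_le x j : Rnorm (x j) <= Rnorm x.
Proof.
apply: (@powR_le_powR _ q); rewrite ?Rnorm_ge0//.
apply: le_trans (lq_partial_sum_le x j.+1).
by apply: (@le_term_sum _ (fun j => Rnorm (x j) `^ q)) => // k; exact: powR_ge0.
Qed.

Lemma coord_subproof j : (fun x : X => x j : R[i]^o) \in @bounded_op R X R[i]^o.
Proof.
apply/asboolP; split => [a x y //|]; exists 1 => x.
by rewrite mul1r lq_coord_le.
Qed.
Definition coord j : dual X := Bop (coord_subproof j).

Lemma trunc_subproof K (s : nat -> R[i]^o) :
  (fun j => if (j < K)%N then s j else 0 : R[i]^o) \in lq_pred q1.
Proof.
apply: (@lq_mem _ (\sum_(j < K) Rnorm (s j) `^ q)) => J.
apply: le_trans (@sum_ord_supp_le _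
  (fun j => Rnorm (if (j < K)%N then s j else 0 : R[i]^o) `^ q) K J _ _) _.
- by move=> k; exact: powR_ge0.
- by move=> k Kk; rewrite ltnNge Kk /= Rnorm0 powR0 ?gt_eqF.
- by apply: ler_sum => k _; rewrite ltn_ord.
Qed.
Definition trunc K s : X := Lq (trunc_subproof K s).

#[local] Arguments trunc : simpl never.

Lemma truncE K s j : trunc K s j = if (j < K)%N then s j else 0. Proof. by []. Qed.

Definition basis k : X := trunc k.+1 (fun j => (j == k)%:R).

Lemma basisE k j : basis k j = (j == k)%:R.
Proof.
by rewrite truncE ltnS; case: (ltngtP j k) => //= ->; rewrite leqnn.
Qed.

Lemma lq_ext x y : (forall j, x j = y j) -> x = y.
Proof. by move=> xy; apply/val_inj/funext. Qed.

Lemma lq_subE x y j : (x - y) j = x j - y j. Proof. by []. Qed.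

Lemma lq_sumE K (c : nat -> R[i]) (f : nat -> X) j :
  (\sum_(k < K) c k *: f k) j = \sum_(k < K) c k * (f k j : R[i]).
Proof.
elim: K => [|K IH]; first by rewrite !big_ord0.
by rewrite !big_ord_recr /= -IH.
Qed.

Lemma trunc_sum K s : trunc K s = \sum_(k < K) (s k : R[i]) *: basis k.
Proof.
apply: lq_ext => j; rewrite lq_sumE truncE.
under eq_bigr do rewrite basisE.
have [jK|Kj] := ltnP j K.
  rewrite (bigD1 (Ordinal jK)) //= eqxx mulr1 big1 ?addr0// => i ij.
  rewrite (_ : (j == i :> nat) = false) ?mulr0//.
  by apply/negbTE; apply: contraNN ij => /eqP ji; apply/eqP/val_inj.
rewrite big1// => i _; rewrite gtn_eqF ?mulr0//.
exact: leq_trans (ltn_ord i) Kj.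
Qed.

Lemma Rnorm_trunc K s : Rnorm (trunc K s) `^ q = \sum_(k < K) Rnorm (s k) `^ q.
Proof.
apply/le_anti/andP; split; last first.
  apply: le_trans (lq_partial_sum_le _ K); apply: ler_sum => k _.
  by rewrite truncE ltn_ord.
have S0 : 0 <= \sum_(k < K) Rnorm (s k) `^ q by apply: sumr_ge0 => *; exact: powR_ge0.
rewrite -[leRHS](powRVK q_gt0)//; apply: le_powR; rewrite ?(ltW q_gt0) ?Rnorm_ge0//.
apply: lq_norm_le; first exact: powR_ge0.
move=> J; rewrite powRVK//.
apply: le_trans (@sum_ord_supp_le _ (fun j => Rnorm (trunc K s j) `^ q) K J _ _) _.
- by move=> k; exact: powR_ge0.
- by move=> k Kk; rewrite truncE ltnNge Kk /= Rnorm0 powR0 ?gt_eqF.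
- by apply: ler_sum => k _; rewrite truncE ltn_ord.
Qed.

Lemma trunc_approx x (e : R) : 0 < e ->
  exists N, forall K, (N <= K)%N -> Rnorm (x - trunc K x) <= e.
Proof.
move=> e0; have eq0 : 0 < e `^ q by rewrite powR_gt0.
have [N NP] := series_tail (fun k => powR_ge0 (Rnorm (x k)) q) (lq_partial_sum_le x) eq0.
exists N => K NK; apply: lq_norm_le; first exact: ltW.
move=> J; apply: le_trans (NP J); rewrite [leRHS]big_mkcond; apply: ler_sum => j _.
rewrite lq_subE truncE.
have [jK|Kj] := ltnP j K.
  by rewrite subrr Rnorm0 powR0 ?gt_eqF//; case: ifP => // _; exact: powR_ge0.
by rewrite subr0 (leq_trans NK Kj).
Qed.

(** Finitely supported vectors are dense, so an inequality for a Lipschitz function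
can be checked on truncations. *)
Lemma le_of_trunc (h : X -> R) (C c : R) x : 0 <= C ->
  (forall y, h x <= h y + C * Rnorm (x - y)) ->
  (forall K, h (trunc K x) <= c) -> h x <= c.
Proof.
move=> C0 hC hc; apply/ler_addgt0Pr => e e0.
have e0' : 0 < e / (C + 1) by rewrite divr_gt0// ltr_wpDl.
have [N NP] := trunc_approx x e0'.
apply: le_trans (hC (trunc N x)) _; apply: lerD; first exact: hc.
apply: (@le_trans _ _ (C * (e / (C + 1)))); first by apply: ler_wpM2l => //; exact: NP.
by rewrite mulrCA ler_piMr ?(ltW e0)// ler_pdivrMr ?ltr_wpDl// mul1r lerDl.
Qed.

Lemma Rnorm_sum_le (V : normedModType R[i]) K (f : nat -> V) :
  Rnorm (\sum_(k < K) f k) <= \sum_(k < K) Rnorm (f k).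
Proof.
elim: K => [|K IH]; first by rewrite !big_ord0 Rnorm0.
by rewrite !big_ord_recr /=; apply: le_trans (ler_RnormD _ _) _; rewrite lerD2r.
Qed.

Lemma Rnorm_opp (V : normedModType R[i]) (u : V) : Rnorm (- u) = Rnorm u.
Proof. by rewrite /Rnorm normrN. Qed.

Lemma Rnorm_real (r : R) : Rnorm (r%:C : R[i]^o) = `|r|.
Proof. by rewrite Rnorm_normc /= expr0n addr0 sqrtr_sqr. Qed.

Lemma RnormM (w z : R[i]) : Rnorm (w * z : R[i]^o) = Rnorm (w : R[i]^o) * Rnorm (z : R[i]^o).
Proof. by rewrite !Rnorm_normc ComplexField.Normc.normcM. Qed.

End sequence_space.

(** * Positive contractions as matrices *)

Section operators.
Local Open Scope complex_scope.
Context {R : realType} {q : R} {q1 : 1 <= q}.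
Hypothesis q_gt1 : 1 < q.
Local Notation X := (lq q1).
Local Notation trunc := (@trunc R q q1 q_gt1).
Local Notation basis := (@basis R q q1 q_gt1).
Local Notation coord := (@coord R q q1 q_gt1).
Implicit Types x y : X.
Implicit Types S T : bop X X.
Implicit Types a : nat -> nat -> R.

Let q_gt0 : 0 < q. Proof. exact: lt_trans q_gt1. Qed.

Definition mx_of T (j k : nat) : R := complex.Re (T (basis k) j : R[i]).

Lemma positive_vec_basis k : positive_vec (basis k).
Proof. by move=> j; rewrite basisE; exact: ler0n. Qed.

Lemma mx_ofE T j k : P1 q1 T -> (T (basis k) j : R[i]) = (mx_of T j k)%:C.
Proof.
move=> [Tpos _]; have := Tpos _ (positive_vec_basis k) j.
by rewrite /mx_of; case: (T _ _) => u v; rewrite lecE /= => /andP[/eqP-> _].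
Qed.

Lemma mx_of_ge0 T j k : P1 q1 T -> 0 <= mx_of T j k.
Proof.
move=> TP; have [Tpos _] := TP; have := Tpos _ (positive_vec_basis k) j.
by rewrite mx_ofE// ler0c.
Qed.

Lemma P1_le T x : P1 q1 T -> Rnorm (T x) <= Rnorm x.
Proof.
move=> [_ T1]; apply: le_trans (Rnorm_le_opnorm T x) _.
by rewrite ler_piMl ?Rnorm_ge0.
Qed.

Lemma op_trunc T K (s : nat -> R[i]^o) :
  T (trunc K s) = \sum_(k < K) (s k : R[i]) *: T (basis k).
Proof.
rewrite trunc_sum linear_sum; apply: eq_bigr => k _; exact: linearZ.
Qed.

Lemma P1_trunc T K (s : nat -> R[i]^o) j : P1 q1 T ->
  T (trunc K s) j = \sum_(k < K) (s k : R[i]) * (mx_of T j k)%:C.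
Proof.
move=> TP; rewrite op_trunc.
rewrite [LHS](@lq_sumE _ _ _ K s (fun k => T (basis k)) j).
apply: eq_bigr => k _; by rewrite mx_ofE.
Qed.

Lemma mx_of_contractive T : P1 q1 T -> contractive q (mx_of T).
Proof.
move=> TP; split=> [j k|J K x x0]; first exact: mx_of_ge0.
pose s k : R[i]^o := (x k)%:C.
have Ts j : T (trunc K s) j = (mxapp (mx_of T) K x j)%:C.
  rewrite P1_trunc// /mxapp rmorph_sum; apply: eq_bigr => k _.
  by rewrite rmorphM mulrC.
have -> : \sum_(k < K) x k `^ q = Rnorm (trunc K s) `^ q.
  by rewrite Rnorm_trunc; apply: eq_bigr => k _; rewrite Rnorm_real ger0_norm.
apply: (@le_trans _ _ (Rnorm (T (trunc K s)) `^ q)); last first.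
  by apply: le_powR; rewrite ?(ltW q_gt0) ?Rnorm_ge0 ?P1_le.
apply: le_trans (lq_partial_sum_le q_gt1 _ J); apply: ler_sum => j _.
rewrite Ts Rnorm_real ger0_norm// mxapp_ge0// => i k; exact: mx_of_ge0.
Qed.

(** Convergence of the real and imaginary parts, which reduces complex row series to
absolutely convergent real ones. *)
Definition ccvg (s : nat -> R[i]) (z : R[i]) :=
  complex.Re (s n) @[n --> \oo] --> complex.Re z /\
  complex.Im (s n) @[n --> \oo] --> complex.Im z.

Lemma ccvg_unique s z w : ccvg s z -> ccvg s w -> z = w.
Proof.
move=> [zr zi] [wr wi]; apply/eqP; rewrite eq_complex.
by rewrite (cvg_unique _ zr wr) ?(cvg_unique _ zi wi) ?eqxx//; exact: Rhausdorff.
Qed.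

Lemma ccvgD s t z w : ccvg s z -> ccvg t w -> ccvg (fun n => s n + t n) (z + w).
Proof.
move=> [zr zi] [wr wi]; split.
- have -> : complex.Re (z + w) = complex.Re z + complex.Re w by case: z {zr zi}; case: w {wr wi}.
  rewrite (_ : (fun n => _) = (fun n => complex.Re (s n)) \+ (fun n => complex.Re (t n))).
    exact: cvgD.
  by apply/funext => n /=; case: (s n); case: (t n).
- have -> : complex.Im (z + w) = complex.Im z + complex.Im w by case: z {zr zi}; case: w {wr wi}.
  rewrite (_ : (fun n => _) = (fun n => complex.Im (s n)) \+ (fun n => complex.Im (t n))).
    exact: cvgD.
  by apply/funext => n /=; case: (s n); case: (t n).
Qed.

Lemma ccvgZ c s z : ccvg s z -> ccvg (fun n => c * s n) (c * z).
Proof.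
move=> [zr zi]; case: c => u v; split.
- have -> : complex.Re ((u +i* v) * z) = u * complex.Re z - v * complex.Im z by case: z {zr zi}.
  rewrite (_ : (fun n => _) = (fun n => u * complex.Re (s n)) \- (fun n => v * complex.Im (s n))).
    by apply: cvgB; apply: cvgMr.
  by apply/funext => n /=; case: (s n).
- have -> : complex.Im ((u +i* v) * z) = u * complex.Im z + v * complex.Re z by case: z {zr zi}.
  rewrite (_ : (fun n => _) = (fun n => u * complex.Im (s n)) \+ (fun n => v * complex.Re (s n))).
    by apply: cvgD; apply: cvgMr.
  by apply/funext => n /=; case: (s n).
Qed.

Lemma ccvg_norm s z : ccvg s z ->
  Rnorm (s n : R[i]^o) @[n --> \oo] --> Rnorm (z : R[i]^o).
Proof.
move=> [zr zi]; rewrite Rnorm_normc.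
have nE (w : R[i]) : ComplexField.Normc.normc w =
    Num.sqrt (complex.Re w * complex.Re w + complex.Im w * complex.Im w).
  by case: w => u v /=; rewrite !expr2.
rewrite nE; under eq_fun do rewrite Rnorm_normc nE.
apply: (cvg_comp _ (@Num.sqrt R) _ (@sqrt_continuous R _)).
by apply: cvgD; apply: cvgM.
Qed.

Lemma ccvg_cst_near s z N : (forall n, (N <= n)%N -> s n = z) -> ccvg s z.
Proof.
move=> sz; split; apply: cvg_near_cst; exists N => // n /= Nn; by rewrite sz.
Qed.

Definition row_sum a x j (K : nat) : R[i] := \sum_(k < K) (x k : R[i]) * (a j k)%:C.

Lemma row_sum_norm a x j K : contractive q a ->
  Rnorm (row_sum a x j K : R[i]^o) <= mxapp a K (fun k => Rnorm (x k)) j.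
Proof.
move=> ac; apply: le_trans (@Rnorm_sum_le _ R[i]^o K
  (fun k => (x k : R[i]) * (a j k)%:C)) _; apply: ler_sum => k _.
by rewrite RnormM Rnorm_real ger0_norm ?ac.1// mulrC.
Qed.

Lemma Re_row_sum a x j K :
  complex.Re (row_sum a x j K) = \sum_(k < K) a j k * complex.Re (x k : R[i]).
Proof.
elim: K => [|K IH]; first by rewrite /row_sum !big_ord0.
rewrite /row_sum !big_ord_recr /= -IH /row_sum.
by case: (\sum_(i < K) _) => u v; case: (x K) => u' v' /=; ring.
Qed.

Lemma Im_row_sum a x j K :
  complex.Im (row_sum a x j K) = \sum_(k < K) a j k * complex.Im (x k : R[i]).
Proof.
elim: K => [|K IH]; first by rewrite /row_sum !big_ord0.
rewrite /row_sum !big_ord_recr /= -IH /row_sum.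
by case: (\sum_(i < K) _) => u v; case: (x K) => u' v' /=; ring.
Qed.

Lemma abs_sum_cvg (u v : nat -> R) (C : R) : (forall k, `|u k| <= v k) ->
  (forall K, \sum_(k < K) v k <= C) -> cvgn (fun K => \sum_(k < K) u k).
Proof.
move=> uv vC.
have E (w : nat -> R) : (fun K => \sum_(k < K) w k) = series w.
  by apply/funext => K; rewrite /series /= big_mkord.
rewrite E; apply: normed_cvg.
have : cvgn (fun K => \sum_(k < K) `|u k|); last by rewrite (E (fun k => `|u k|)).
apply: nondecreasing_is_cvgn.
  by move=> m n mn; apply: (@le_sum_ord_widen _ (fun k => `|u k|)).
exists C => _ [K _ <-]; apply: le_trans (vC K); exact: ler_sum.
Qed.

Lemma row_sum_cvg a x j : contractive q a -> exists z, ccvg (row_sum a x j) z.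
Proof.
move=> ac.
have B K : \sum_(k < K) a j k * Rnorm (x k) <= Rnorm x.
  apply: (@powR_le_powR _ q); rewrite ?Rnorm_ge0//.
    by apply: sumr_ge0 => k _; rewrite mulr_ge0 ?ac.1 ?Rnorm_ge0.
  apply: le_trans (lq_partial_sum_le q_gt1 x K).
  apply: le_trans (ac.2 j.+1 K (fun k => Rnorm (x k)) (fun k => Rnorm_ge0 _)).
  by apply: (@le_term_sum _ (fun j => mxapp a K (fun k => Rnorm (x k)) j `^ q)) => // i; exact: powR_ge0.
have reC : cvgn (fun K => \sum_(k < K) a j k * complex.Re (x k : R[i])).
  apply: (@abs_sum_cvg (fun k => a j k * complex.Re (x k : R[i]))
    (fun k => a j k * Rnorm (x k)) _ _ B) => k; rewrite normrM ger0_norm ?ac.1//.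
  apply: ler_wpM2l; first exact: ac.1.
  rewrite Rnorm_normc; case: (x k) => u v /=.
  by rewrite -sqrtr_sqr ler_wsqrtr// lerDl sqr_ge0.
have imC : cvgn (fun K => \sum_(k < K) a j k * complex.Im (x k : R[i])).
  apply: (@abs_sum_cvg (fun k => a j k * complex.Im (x k : R[i]))
    (fun k => a j k * Rnorm (x k)) _ _ B) => k; rewrite normrM ger0_norm ?ac.1//.
  apply: ler_wpM2l; first exact: ac.1.
  rewrite Rnorm_normc; case: (x k) => u v /=.
  by rewrite -sqrtr_sqr ler_wsqrtr// lerDr sqr_ge0.
exists (limn (fun K => \sum_(k < K) a j k * complex.Re (x k : R[i])) +i*
        limn (fun K => \sum_(k < K) a j k * complex.Im (x k : R[i]))).
split => /=.
- by under eq_fun do rewrite Re_row_sum.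
- by under eq_fun do rewrite Im_row_sum.
Qed.

(** Contractivity applied to the moduli of the coordinates of x makes every row
series converge absolutely; the norm bound for the resulting vector passes to
the limit coordinate by coordinate. *)
Lemma op_of_mx a : contractive q a -> exists2 T, P1 q1 T & mx_of T = a.
Proof.
move=> ac; have /choice[phi phiP] : forall p : X * nat, exists z, ccvg (row_sum a p.1 p.2) z.
  by move=> [x j]; exact: row_sum_cvg.
have phi_norm x J : \sum_(j < J) Rnorm (phi (x, j : nat) : R[i]^o) `^ q <= Rnorm x `^ q.
  apply: (@cvgn_le _ (fun K => \sum_(j < J) Rnorm (row_sum a x j K : R[i]^o) `^ q)).
    apply: (@cvg_sum_ord _ J (fun K j => Rnorm (row_sum a x j K : R[i]^o) `^ q)
      (fun j => Rnorm (phi (x, j) : R[i]^o) `^ q)) => j.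
    apply: (cvg_powR q_gt1) => [n|]; first exact: Rnorm_ge0.
    exact: ccvg_norm (phiP (x, j)).
  move=> K; apply: le_trans (lq_partial_sum_le q_gt1 x K).
  apply: le_trans (ac.2 J K (fun k => Rnorm (x k)) (fun k => Rnorm_ge0 _)).
  apply: ler_sum => j _; apply: le_powR; rewrite ?(ltW q_gt0) ?Rnorm_ge0//.
  exact: row_sum_norm.
pose F x : X := Lq (@lq_mem _ _ q1 (fun j => phi (x, j)) _ (phi_norm x)).
have Fbounded : F \in @bounded_op R X X.
  apply/asboolP; split.
    move=> c x y; apply: lq_ext => j.
    apply: (@ccvg_unique (row_sum a (c *: x + y) j)); first exact: phiP (_, j).
    rewrite (_ : row_sum _ _ _ = fun K => c * row_sum a x j K + row_sum a y j K).
      apply: ccvgD; last exact: phiP (_, j).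
      by apply: ccvgZ; exact: phiP (_, j).
    apply/funext => K; rewrite /row_sum mulr_sumr -big_split; apply: eq_bigr => k _ /=.
    by rewrite mulrA -mulrDl.
  by exists 1 => x; rewrite mul1r; apply: (lq_norm_le q_gt1); rewrite ?Rnorm_ge0//; exact: phi_norm.
pose T := Bop Fbounded.
have TE x j : ccvg (row_sum a x j) (T x j) by exact: phiP (_, j).
exists T.
  split.
    move=> x x0 j; have [re im] := TE x j; rewrite lecE /=; apply/andP; split.
      have im0 : complex.Im (row_sum a x j n) @[n --> \oo] --> (0 : R).
        apply: cvg_near_cst; near=> n; rewrite Im_row_sum; apply: big1 => k _.
        by rewrite (ger0_Im (x0 k)) mulr0.
      by apply/eqP; apply: (cvg_unique _ im im0); exact: Rhausdorff.
    apply: (cvgr_to_ge re); near=> n; rewrite Re_row_sum; apply: sumr_ge0 => k _.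
    rewrite mulr_ge0 ?ac.1//.
    by have := x0 k; rewrite lecE => /andP[].
  apply: opnorm_le => x; apply: le_trans.
  by apply: (lq_norm_le q_gt1); rewrite ?Rnorm_ge0//; exact: phi_norm.
apply/funext => j; apply/funext => k; rewrite /mx_of.
rewrite (_ : T (basis k) j = (a j k)%:C :> R[i])//.
apply: (ccvg_unique (TE _ _)).
apply: (@ccvg_cst_near _ _ k.+1) => n kn; rewrite /row_sum.
under eq_bigr do rewrite basisE.
rewrite (bigD1 (Ordinal kn)) //= eqxx mul1r big1 ?addr0// => i ik.
rewrite (_ : (i == k :> nat) = false) ?mul0r//.
by apply/negbTE; apply: contraNN ik => /eqP ji; apply/eqP/val_inj.
Unshelve. all: by end_near. Qed.

End operators.

(** * Neighbourhoods in terms of columns and rows *)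

Lemma small_inv_succ (R : realType) (N : nat) (e : R) : 0 < e ->
  exists2 n, (N <= n)%N & n.+1%:R^-1 <= e.
Proof.
move=> e0; exists (N + Num.bound e^-1)%N; first exact: leq_addr.
rewrite invf_ple ?posrE//; apply/ltW.
have /lt_le_trans : e^-1 < (Num.bound e^-1)%:R.
  by apply: archi_boundP; rewrite invr_ge0 ltW.
by apply; rewrite ler_nat ltnW// ltnS leq_addl.
Qed.

Section neighborhoods.
Local Open Scope complex_scope.
Context {R : realType} {q : R} {q1 : 1 <= q}.
Hypothesis q_gt1 : 1 < q.
Local Notation X := (lq q1).
Local Notation trunc := (@trunc R q q1 q_gt1).
Local Notation basis := (@basis R q q1 q_gt1).
Local Notation coord := (@coord R q q1 q_gt1).
Local Notation mx_of := (@mx_of R q q1 q_gt1).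
Implicit Types x y : X.
Implicit Types S T : bop X X.

Let q_gt0 : 0 < q. Proof. exact: lt_trans q_gt1. Qed.

Lemma P1_sub_le S T x : P1 q1 S -> P1 q1 T -> Rnorm (S x - T x) <= 2 * Rnorm x.
Proof.
move=> SP TP; apply: le_trans (ler_RnormD _ _) _; rewrite Rnorm_opp.
by rewrite mulrDl mul1r; apply: lerD; exact: P1_le.
Qed.

(** Contractions are equicontinuous, so convergence on basis vectors gives
convergence everywhere. *)
Lemma col_near_pointwise T x (e : R) : P1 q1 T -> 0 < e ->
  exists n, forall S, P1 q1 S -> col_near q n n.+1%:R^-1 (mx_of T) (mx_of S) ->
    Rnorm (S x - T x) < e.
Proof.
move=> TP e0; have e40 : 0 < e / 4 by rewrite divr_gt0.
have [N NP] := trunc_approx q_gt1 x e40.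
pose A := \sum_(k < N) Rnorm (x k) + 1.
have A0 : 0 < A by rewrite ltr_wpDl// sumr_ge0// => k _; exact: Rnorm_ge0.
have d0 : 0 < (e / 4 / A) `^ q by rewrite powR_gt0// divr_gt0.
have [n Nn nd] := small_inv_succ N d0.
exists n => S SP ST.
have -> : S x - T x = (S (x - trunc N x) - T (x - trunc N x)) +
    (S (trunc N x) - T (trunc N x)).
  rewrite (linearB S) (linearB T) opprB -addrA [X in _ = _ + X]addrC.
  by rewrite subrKA addrA subrK.
have : Rnorm (S (x - trunc N x) - T (x - trunc N x)) <= 2 * (e / 4).
  by apply: le_trans (P1_sub_le _ SP TP) _; apply: ler_wpM2l => //; exact: NP.
have : Rnorm (S (trunc N x) - T (trunc N x)) <= e / 4.
  rewrite !(op_trunc q_gt1) -sumrB.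
  apply: le_trans (Rnorm_sum_le N (fun k => (x k : R[i]) *: S (basis k) - (x k : R[i]) *: T (basis k))) _.
  apply: (@le_trans _ _ (\sum_(k < N) Rnorm (x k) * (e / 4 / A))).
    apply: ler_sum => k _; rewrite -scalerBr RnormZ -Rnorm_normc; apply: ler_wpM2l; first exact: Rnorm_ge0.
    have eA : 0 <= e / 4 / A by rewrite divr_ge0 ?ltW.
    apply: (lq_norm_le q_gt1) => // J.
    apply: le_trans nd; apply: le_trans (ST k J (leq_trans (ltn_ord k) Nn)).
    apply: ler_sum => j _; rewrite lq_subE (mx_ofE q_gt1)// (mx_ofE q_gt1)//.
    by rewrite -rmorphB Rnorm_real distrC.
  rewrite -mulr_suml mulrA ler_pdivrMr// mulrC ler_wpM2l ?(ltW e40)//.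
  by rewrite lerDl.
move=> H1 H2; apply: le_lt_trans (ler_RnormD _ _) _; lra.
Qed.

Lemma col_near_of_norms S T n (d : R) : P1 q1 S -> P1 q1 T -> 0 <= d ->
  (forall k, (k < n)%N -> Rnorm (S (basis k) - T (basis k)) <= d `^ q^-1) ->
  col_near q n d (mx_of T) (mx_of S).
Proof.
move=> SP TP d0 H k J kn; rewrite -[leRHS](powRVK q_gt0 d0).
apply: (@le_trans _ _ (Rnorm (S (basis k) - T (basis k)) `^ q)); last first.
  by apply: le_powR; rewrite ?(ltW q_gt0) ?Rnorm_ge0 ?H.
apply: le_trans (lq_partial_sum_le q_gt1 _ J).
apply: ler_sum => j _; rewrite lq_subE (mx_ofE q_gt1)// (mx_ofE q_gt1)//.
by rewrite -rmorphB Rnorm_real distrC.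
Qed.

(** The row difference is paired with y by evaluating both operators at the vector
whose coordinates are y with the signs of the difference. *)
Lemma row_near_of_norms S T n (d : R) : P1 q1 S -> P1 q1 T ->
  (forall j, (j < n)%N -> Rnorm (adjoint S (coord j) - adjoint T (coord j)) <= d) ->
  row_near q n d (mx_of T) (mx_of S).
Proof.
move=> SP TP H j K y jn y0 y1.
pose b k := mx_of S j k - mx_of T j k.
pose s k : R[i]^o := (Num.sg (b k) * y k)%:C.
have s1 : Rnorm (trunc K s) <= 1.
  apply: (powR_le1 q_gt1); first exact: Rnorm_ge0.
  rewrite Rnorm_trunc; apply: le_trans y1; apply: ler_sum => k _.
  apply: le_powR; rewrite ?(ltW q_gt0) ?Rnorm_ge0// /s Rnorm_real.
  by rewrite normrM (ger0_norm (y0 _)) ler_piMl// normr_sg; case: (_ != 0).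
apply: le_trans (H j jn); set D := adjoint S _ - _.
apply: (@le_trans _ _ (Rnorm (D (trunc K s)))); last first.
  apply: le_trans (Rnorm_le_opnorm D _) _; rewrite Rnorm_bop.
  by rewrite ler_piMr// opnorm_ge0.
have -> : D (trunc K s) = S (trunc K s) j - T (trunc K s) j by [].
rewrite !(P1_trunc q_gt1)// -sumrB.
have -> : \sum_(k < K) (s k * (mx_of S j k)%:C - s k * (mx_of T j k)%:C) =
    (\sum_(k < K) `|mx_of T j k - mx_of S j k| * y k)%:C.
  rewrite rmorph_sum; apply: eq_bigr => k _ /=.
  rewrite -mulrBr -rmorphB -rmorphM /= distrC [X in _ = (X * _)%:C]normrEsg.
  by congr (_%:C); rewrite /b; ring.
by rewrite Rnorm_real ler_norm.
Qed.

Lemma phase (w : R[i]) : exists2 p : R[i], p * w = (Rnorm (w : R[i]^o))%:C & 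
  Rnorm (p : R[i]^o) <= 1.
Proof.
have [->|w0] := eqVneq w 0; first by exists 0; rewrite ?mulr0 Rnorm0.
exists ((Rnorm (w : R[i]^o))%:C / w); first by rewrite mulfVK.
rewrite RnormM Rnorm_real (ger0_norm (Rnorm_ge0 _)).
rewrite [X in _ * X]Rnorm_normc ComplexField.Normc.normcV -Rnorm_normc mulfV//.
by apply: contra_neq w0 => /Rnorm0_eq0.
Qed.

(** The phases of the coordinates of the test vector are chosen so that all terms of
f become nonnegative. *)
Lemma functional_row (f : dual X) K (y : nat -> R) : (forall k, 0 <= y k) ->
  \sum_(k < K) y k `^ q <= 1 ->
  \sum_(k < K) Rnorm (f (basis k)) * y k <= opnorm f.
Proof.
move=> y0 y1.
have /choice[p pP] : forall k, exists p : R[i],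
    p * f (basis k) = (Rnorm (f (basis k)))%:C /\ Rnorm (p : R[i]^o) <= 1.
  by move=> k; have [p] := phase (f (basis k)); exists p.
pose s k : R[i]^o := (y k)%:C * p k.
have s1 : Rnorm (trunc K s) <= 1.
  apply: (powR_le1 q_gt1); first exact: Rnorm_ge0.
  rewrite Rnorm_trunc; apply: le_trans y1; apply: ler_sum => k _.
  apply: le_powR; rewrite ?(ltW q_gt0) ?Rnorm_ge0// /s RnormM Rnorm_real.
  by rewrite (ger0_norm (y0 _)) ler_piMr//; exact: (pP k).2.
apply: (@le_trans _ _ (Rnorm (f (trunc K s)))); last first.
  by apply: le_trans (Rnorm_le_opnorm f _) _; rewrite ler_piMr ?opnorm_ge0.
have -> : f (trunc K s) = (\sum_(k < K) Rnorm (f (basis k)) * y k)%:C.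
  rewrite trunc_sum linear_sum rmorph_sum; apply: eq_bigr => k _ /=.
  rewrite linearZ /= rmorphM /= -(pP k).1 /s.
  by rewrite [RHS]mulrC mulrA.
by rewrite Rnorm_real ler_norm.
Qed.

Lemma row_near_coord S T n (d : R) j x : P1 q1 S -> P1 q1 T -> 
  row_near q n d (mx_of T) (mx_of S) -> (j < n)%N -> Rnorm x <= 1 ->
  Rnorm ((S x - T x) j) <= d.
Proof.
move=> SP TP H jn x1.
apply: (@le_of_trunc _ _ _ q_gt1 (fun x => Rnorm ((S x - T x) j)) 2) => // [y|K].
  have -> : (S x - T x) j = (S y - T y) j + (S (x - y) - T (x - y)) j.
    rewrite (linearB S) (linearB T) !lq_subE; ring.
  apply: le_trans (ler_RnormD _ _) _; rewrite lerD2l.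
  apply: le_trans (lq_coord_le q_gt1 _ _) _.
  exact: P1_sub_le.
rewrite lq_subE !(P1_trunc q_gt1)// -sumrB.
apply: le_trans (@Rnorm_sum_le _ R[i]^o K
  (fun k => (x k : R[i]) * (mx_of S j k)%:C - (x k : R[i]) * (mx_of T j k)%:C)) _.
apply: le_trans (H j K (fun k => Rnorm (x k)) jn (fun k => Rnorm_ge0 _) _); last first.
  apply: le_trans (lq_partial_sum_le q_gt1 x K) _.
  by have := le_powR (ltW q_gt0) (Rnorm_ge0 x) x1; rewrite powR1.
apply: ler_sum => k _; rewrite -mulrBr -rmorphB RnormM Rnorm_real distrC.
by rewrite mulrC.
Qed.

(** The vector D = S x - T x has norm at most 2, its first coordinates are small by
row proximity, and f is small on the remaining ones because the tails of a
functional vanish. *)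
Lemma row_near_adjoint T (f : dual X) (e : R) : P1 q1 T -> 0 < e ->
  exists n, forall S, P1 q1 S -> row_near q n n.+1%:R^-1 (mx_of T) (mx_of S) ->
    Rnorm (adjoint S f - adjoint T f) < e.
Proof.
move=> TP e0; have e80 : 0 < e / 8 by rewrite divr_gt0.
pose u k := Rnorm (f (basis k)).
have u0 k : 0 <= u k by exact: Rnorm_ge0.
have [N NP] := row_tail q_gt1 u0 (functional_row f) e80.
pose A := \sum_(k < N) u k + 1.
have A0 : 0 < A by rewrite ltr_wpDl// sumr_ge0.
have d0 : 0 < e / 8 / A by rewrite divr_gt0.
have [n Nn nd] := small_inv_succ N d0.
exists n => S SP ST; apply: (@le_lt_trans _ _ (e / 2)); last by lra.
rewrite Rnorm_bop; apply: opnorm_le => x x1.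
set D := S x - T x.
have -> : (adjoint S f - adjoint T f) x = f D.
  by rewrite /D linearB.
have D2 : Rnorm D <= 2.
  by apply: le_trans (P1_sub_le x SP TP) _; rewrite ler_piMr.
apply: (@le_of_trunc _ _ _ q_gt1 (fun x => Rnorm (f x)) (opnorm f)) => [|y|K].
- exact: opnorm_ge0.
- have -> : f D = f y + f (D - y) by rewrite (linearB f D y) addrC subrK.
  by apply: le_trans (ler_RnormD _ _) _; rewrite lerD2l Rnorm_le_opnorm.
have -> : f (trunc K D) = \sum_(k < K) ((D k : R[i]) *: f (basis k) : R[i]^o).
  by rewrite trunc_sum linear_sum; apply: eq_bigr => k _; exact: linearZ.
apply: le_trans (@Rnorm_sum_le _ R[i]^o K (fun k => (D k : R[i]) *: f (basis k))) _.
have -> : \sum_(k < K) Rnorm ((D k : R[i]) *: f (basis k)) = \sum_(k < K) u k * Rnorm (D k).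
  by apply: eq_bigr => k _; rewrite RnormZ mulrC.
rewrite (bigID (fun k : 'I_K => (N <= k)%N)) /=.
rewrite [leRHS](_ : e / 2 = 2 * (e / 8) + 2 * (e / 8)); last by lra.
apply: lerD.
  have yq : \sum_(k < K) (Rnorm (D k) / 2) `^ q <= 1.
    have -> : \sum_(k < K) (Rnorm (D k) / 2) `^ q = (2^-1) `^ q * \sum_(k < K) Rnorm (D k) `^ q.
      by rewrite mulr_sumr; apply: eq_bigr => k _; rewrite mulrC powRM// Rnorm_ge0.
    apply: (@le_trans _ _ (2^-1 `^ q * Rnorm D `^ q)).
      by apply: ler_wpM2l; rewrite ?powR_ge0// lq_partial_sum_le.
    rewrite -powRM ?Rnorm_ge0//; have := @le_powR _ q (2^-1 * Rnorm D) 1 (ltW q_gt0).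
    rewrite powR1; apply; first by rewrite mulr_ge0 ?Rnorm_ge0.
    by rewrite mulrC ler_pdivrMr// mul1r.
  have y0 k : 0 <= Rnorm (D k) / 2 by rewrite divr_ge0 ?Rnorm_ge0.
  have := NP K (fun k => Rnorm (D k) / 2) y0 yq.
  have -> : \sum_(k < K | (N <= k)%N) u k * (Rnorm (D k) / 2) =
      (\sum_(k < K | (N <= k)%N) u k * Rnorm (D k)) / 2.
    by rewrite mulr_suml; apply: eq_bigr => k _; rewrite mulrA.
  by rewrite ler_pdivrMr// [_ * 2]mulrC.
apply: (@le_trans _ _ (\sum_(k < N) u k * (e / 8 / A))).
  apply: (@le_trans _ _ (\sum_(k < K | (k < N)%N) u k * (e / 8 / A))).
    rewrite [leLHS](_ : _ = \sum_(k < K | (k < N)%N) u k * Rnorm (D k)); last first.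
      by apply: eq_bigl => k; rewrite -ltnNge.
    apply: ler_sum => k kN; apply: ler_wpM2l => //; apply: le_trans nd.
    exact: (row_near_coord SP TP ST (leq_trans kN Nn) x1).
  rewrite big_mkcond; apply: le_trans (@sum_ord_supp_le _
    (fun k => if (k < N)%N then u k * (e / 8 / A) else 0) N K _ _) _ => [k|k Nk|].
  - by case: ifP => // _; rewrite mulr_ge0// ltW.
  - by rewrite ltnNge Nk.
  - by apply: ler_sum => k _; rewrite ltn_ord.
rewrite -mulr_suml mulrA ler_pdivrMr// mulrC.
have : e / 8 * \sum_(k < N) u k <= e / 8 * A by rewrite ler_wpM2l ?(ltW e80)// lerDl.
have : 0 <= e / 8 * A by rewrite mulr_ge0 ?ltW.
by lra.
Qed.

End neighborhoods.

(** * Baire spaces and transfer of comeager sets *)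

(** The classical argument, for spaces with countable neighbourhood bases that need
not be presented by a metric: completeness enters only through nested
sequences of basic neighbourhoods. *)
Lemma baire_of_nested (T : topologicalType) (E : nat -> T -> set T) :
  (forall n t, nbhs t (E n t)) ->
  (forall t U, nbhs t U -> exists n, E n t `<=` U) ->
  (forall m n t, (m <= n)%N -> E n t `<=` E m t) ->
  (forall (t : nat -> T) (n : nat -> nat), (forall i, (i <= n i)%N) ->
    (forall i, E (n i.+1) (t i.+1) `<=` E (n i) (t i)) ->
    exists s, forall i, E (n i) (t i) s) ->
  baire T.
Proof.
move=> nbhsE Ebase Emono Ecomplete U Ud W [t0 Wt0] Wo.
have [n0 n0W] := Ebase _ _ (open_nbhs_nbhs (conj Wo Wt0)).
have step : forall p : nat * (T * nat), exists p' : nat * (T * nat),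
    [/\ p'.1 = p.1.+1, (p'.1 <= p'.2.2)%N &
      E p'.2.2 p'.2.1 `<=` E p.2.2 p.2.1 `&` U p.1].
  move=> [i [t n]] /=; have [Uo Udense] := Ud i.
  have E0 : (interior (E n t)) !=set0 by exists t; exact: nbhsE.
  have [t' [Et' Ut']] := Udense _ E0 (open_interior (E n t)).
  have [n' n'E] : exists n', E n' t' `<=` E n t `&` U i.
    by apply: Ebase; apply: filterI => //; exact: open_nbhs_nbhs.
  exists (i.+1, (t', maxn i.+1 n')); split=> //=; first exact: leq_maxl.
  by apply: subset_trans n'E; apply: Emono; exact: leq_maxr.
have [g gP] := choice step.
pose f := fix f i := if i is j.+1 then g (f j) else (0%N, (t0, n0)).
have f1 i : (f i).1 = i by elim: i => //= i IH; have [-> _ _] := gP (f i); rewrite IH.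
have fE i : E (f i.+1).2.2 (f i.+1).2.1 `<=` E (f i).2.2 (f i).2.1 `&` U i.
  by have [_ _] := gP (f i); rewrite f1.
have [s sE] : exists s, forall i, E (f i).2.2 (f i).2.1 s.
  apply: Ecomplete => [[//|i]|i x /fE[]//].
  by have [_ + _] := gP (f i); rewrite -/(f i.+1) f1.
exists s; split; first by apply: n0W; exact: (sE 0%N).
by move=> i _; have [] := fE i s (sE i.+1).
Qed.

(** The topology of T1 is finer, but its nonempty open sets still have interior
points for that of T2.  Dense open sets are transported along f in one
direction, and replaced by their interiors in the other. *)
Lemma comeager_transfer (T1 T2 : topologicalType) (f : T1 -> T2) (g : T2 -> T1) :
  cancel f g -> cancel g f -> continuous f ->
  (forall U : set T1, open U -> U !=set0 ->
    exists V : set T2, [/\ open V, V !=set0 & f @^-1` V `<=` U]) ->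
  baire T1 -> baire T2 ->
  forall A : set T2, comeager A <-> comeager (f @^-1` A).
Proof.
move=> fK gK fc refine B1 B2 A; split=> [[G [[F Fo GE] Gd GA]]|[G [[F Fo GE] Gd GA]]].
- exists (f @^-1` G); split.
  + exists (fun i => f @^-1` F i); last by rewrite GE preimage_bigcap.
    by move=> i; apply: open_comp => // x _; exact: fc.
  + rewrite GE preimage_bigcap; apply: B1 => i; split.
      by apply: open_comp => // x _; exact: fc.
    move=> U U0 Uo; have [V [Vo V0 VU]] := refine U Uo U0.
    have [y [Vy Gy]] := Gd V V0 Vo; exists (g y); split.
      by apply: VU; rewrite /preimage /= gK.
    by rewrite /preimage /= gK; move: Gy; rewrite GE; apply.
  + exact: preimage_subset.
- exists (\bigcap_i interior (g @^-1` F i)); split.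
  + by exists (fun i => interior (g @^-1` F i)) => // i; exact: open_interior.
  + apply: B2 => i; split; first exact: open_interior.
    move=> W [w Ww] Wo.
    have fWo : open (f @^-1` W) by apply: open_comp => // x _; exact: fc.
    have fW0 : (f @^-1` W) !=set0 by exists (g w); rewrite /preimage /= gK.
    have [x [Wx Gx]] := Gd _ fW0 fWo.
    have WF0 : (f @^-1` W `&` F i) !=set0 by exists x; split=> //; move: Gx; rewrite GE; apply.
    have [V [Vo [v Vv] VU]] := refine _ (openI fWo (Fo i)) WF0.
    have VgU y : V y -> W y /\ F i (g y).
      by move=> Vy; have := VU (g y); rewrite /preimage /= gK; apply.
    exists v; split; first exact: (VgU v Vv).1.
    apply: (filterS _ (open_nbhs_nbhs (conj Vo Vv))) => y Vy.
    exact: (VgU y Vy).2.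
  + move=> y Gy; have : G (g y).
      by rewrite GE => i _; exact: (interior_subset (Gy i I)).
    by move=> /GA; rewrite /preimage /= gK.
Qed.

(** * The two operator topologies *)

Lemma cvgn_cauchy (R : realType) (u : nat -> R) :
  (forall e, 0 < e -> exists N, forall m, (N <= m)%N -> `|u N - u m| < e) -> cvgn u.
Proof.
move=> uC; apply: cauchy_cvg; apply: cauchy_exP => e e0.
have [N NP] := uC e e0; by exists (u N), N.
Qed.

Section matrix_topology.
Context {R : realType} (q : R).
Hypothesis q_gt1 : 1 < q.
Local Notation mx := (nat -> nat -> R).
Implicit Types a b c : mx.

Let q_gt0 : 0 < q. Proof. exact: lt_trans q_gt1. Qed.

(** The index plays the role both of the number of columns or rows and of the
precision, which gives a countable decreasing base. *)
Definition sot_near (n : nat) a b := col_near q n n.+1%:R^-1 a b.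
Definition sot_star_near (n : nat) a b :=
  sot_near n a b /\ row_near q n n.+1%:R^-1 a b.

Lemma inv_succ_antitone m n : (m <= n)%N -> n.+1%:R^-1 <= m.+1%:R^-1 :> R.
Proof. by move=> mn; rewrite lef_pV2 ?posrE// ler_nat. Qed.

Lemma sot_near_antitone m n a b : (m <= n)%N -> sot_near n a b -> sot_near m a b.
Proof.
move=> mn ab k J km; apply: le_trans (inv_succ_antitone mn).
exact: ab (leq_trans km mn).
Qed.

Lemma sot_star_near_antitone m n a b : (m <= n)%N ->
  sot_star_near n a b -> sot_star_near m a b.
Proof.
move=> mn [ab ab']; split; first exact: sot_near_antitone ab.
move=> j K y jm y0 y1; apply: le_trans (inv_succ_antitone mn).
exact: ab' (leq_trans jm mn) _ _.
Qed.

Lemma sot_near_refl n a : sot_near n a a.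
Proof.
move=> k J _; rewrite big1 ?invr_ge0// => j _.
by rewrite subrr normr0 powR0// gt_eqF.
Qed.

Lemma sot_star_near_refl n a : sot_star_near n a a.
Proof.
split; first exact: sot_near_refl.
move=> j K y _ _ _; rewrite big1 ?invr_ge0// => k _.
by rewrite subrr normr0 mul0r.
Qed.

Lemma cvg_dist (u : nat -> R) (r l : R) : u @ \oo --> l ->
  `|r - u n| @[n --> \oo] --> `|r - l|.
Proof. by move=> ul; apply: cvg_norm; apply: cvgB => //; exact: cvg_cst. Qed.

Lemma sot_near_closed n a (b : nat -> mx) c : (forall m, sot_near n a (b m)) ->
  (forall j k, b m j k @[m --> \oo] --> c j k) -> sot_near n a c.
Proof.
move=> ab bc k J kn.
apply: (@cvgn_le _ (fun m => \sum_(j < J) `|a j k - b m j k| `^ q)); last first.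
  by move=> m; exact: ab.
apply: (@cvg_sum_ord _ J (fun m j => `|a j k - b m j k| `^ q)
  (fun j => `|a j k - c j k| `^ q)) => j.
apply: (cvg_powR q_gt1) => [m|]; first exact: normr_ge0.
exact: cvg_dist.
Qed.

Lemma sot_star_near_closed n a (b : nat -> mx) c : (forall m, sot_star_near n a (b m)) ->
  (forall j k, b m j k @[m --> \oo] --> c j k) -> sot_star_near n a c.
Proof.
move=> ab bc; split; first by apply: sot_near_closed bc => m; exact: (ab m).1.
move=> j K y jn y0 y1.
apply: (@cvgn_le _ (fun m => \sum_(k < K) `|a j k - b m j k| * y k)); last first.
  by move=> m; apply: (ab m).2.
apply: (@cvg_sum_ord _ K (fun m k => `|a j k - b m j k| * y k)
  (fun k => `|a j k - c j k| * y k)) => k.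
by apply: cvgMl; exact: cvg_dist.
Qed.

(** Nested basic neighbourhoods force the entries of their centres to be Cauchy
sequences; the entrywise limit is contractive, hence the matrix of a point, and
it stays in every neighbourhood because these are closed under entrywise limits.
*)
Lemma baire_of_mx_near (S : topologicalType) (M : S -> mx)
    (near : nat -> mx -> mx -> Prop) :
  (forall s, contractive q (M s)) ->
  (forall a, contractive q a -> exists s, M s = a) ->
  (forall (t : S) U, nbhs t U <-> exists n, forall s, near n (M t) (M s) -> U s) ->
  (forall m n a b, (m <= n)%N -> near n a b -> near m a b) ->
  (forall n a, near n a a) ->
  (forall n a b, near n a b -> sot_near n a b) ->
  (forall n a (b : nat -> mx) c, (forall m, near n a (b m)) ->
    (forall j k, b m j k @[m --> \oo] --> c j k) -> near n a c) ->
  baire S.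
Proof.
move=> Mc Msurj nbhsP antitone refl near_sot closed.
apply: (@baire_of_nested _ (fun n t => [set s | near n (M t) (M s)])).
- by move=> n t; apply/nbhsP; exists n.
- by move=> t U /nbhsP[n nU]; exists n.
- by move=> m n t mn s; exact: antitone.
move=> t n ni nested.
have nested' i m : (i <= m)%N -> near (n i) (M (t i)) (M (t m)).
  move=> im; suff : [set s | near (n m) (M (t m)) (M s)] `<=`
      [set s | near (n i) (M (t i)) (M s)] by apply; exact: refl.
  elim: m im => [|m IH]; first by rewrite leqn0 => /eqP ->.
  rewrite leq_eqVlt => /orP[/eqP ->//|/IH]; apply: subset_trans.
  exact: nested.
have entryC j k : cvgn (fun m => M (t m) j k).
  apply: cvgn_cauchy => e e0; have eq0 : 0 < (e / 2) `^ q by rewrite powR_gt0 ?divr_gt0.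
  have [N kN Ne] := small_inv_succ k.+1 eq0; exists N => m Nm.
  apply: (@le_lt_trans _ _ (e / 2)); last by lra.
  apply: (@powR_le_powR _ q) => //; first by rewrite divr_ge0 ?ltW.
  have /near_sot H := nested' N m Nm.
  apply: le_trans (@le_term_sum _ (fun j => `|M (t N) j k - M (t m) j k| `^ q) j j.+1 _ _) _ => //.
  apply: le_trans (H k j.+1 _) _; first by rewrite (leq_trans kN).
  by apply: le_trans Ne; exact: inv_succ_antitone.
pose a j k := limn (fun m => M (t m) j k).
have ta j k : M (t m) j k @[m --> \oo] --> a j k by exact: entryC.
have /Msurj[s sE] : contractive q a by apply: (contractive_lim q_gt1) ta => m; exact: Mc.
exists s => i; rewrite /= sE.
apply: (@closed _ _ (fun m => M (t (m + i)%N))) => [m|j k].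
  by apply: nested'; exact: leq_addl.
by have := ta j k; rewrite -(cvg_shiftn i).
Qed.

End matrix_topology.

Section operator_topologies.
Context {R : realType} {q : R} {q1 : 1 <= q}.
Hypothesis q_gt1 : 1 < q.
Local Notation X := (lq q1).
Local Notation mx_of := (@mx_of R q q1 q_gt1).
Local Notation basis := (@basis R q q1 q_gt1).
Local Notation coord := (@coord R q q1 q_gt1).

Let q_gt0 : 0 < q. Proof. exact: lt_trans q_gt1. Qed.

Let P1P (t : P1 q1) : P1 q1 (\val t). Proof. exact: set_mem (valP t). Qed.

(** The filter generated by candidate basic neighbourhoods; that it converges to
the point means that every neighbourhood contains one of them. *)
Definition near_filter (near : nat -> P1 q1 -> Prop) : set_system (P1 q1) :=
  [set U | exists n, forall s, near n s -> U s].

Lemma near_filter_filter (near : nat -> P1 q1 -> Prop) :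
  (forall m n s, (m <= n)%N -> near n s -> near m s) -> Filter (near_filter near).
Proof.
move=> antitone; split; first by exists 0%N.
- move=> U V [m mU] [n nV]; exists (maxn m n) => s ns; split.
    by apply: mU; apply: antitone ns; exact: leq_maxl.
  by apply: nV; apply: antitone ns; exact: leq_maxr.
- by move=> U V UV [n nU]; exists n => s /nU/UV.
Qed.

Lemma filter_forall_ltn (T : Type) (F : set_system T) (P : nat -> T -> Prop) n :
  Filter F -> (forall k, F (P k)) -> F [set s | forall k, (k < n)%N -> P k s].
Proof.
move=> FF FP; elim: n => [|n IH]; first by apply: filterS filterT.
apply: filterS (filterI IH (FP n)) => s [sn Pn] k.
by rewrite ltnS leq_eqVlt => /orP[/eqP->//|]; exact: sn.
Qed.

Lemma nbhs_le_of_cvg0 (T : topologicalType) (t : T) (f : T -> R) (d : R) : 0 < d ->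
  f @ t --> (0 : R) -> \forall s \near t, f s <= d.
Proof. by move=> d0 f0; apply: (cvgr_le _ f0). Qed.

Lemma nbhs_sotP (t : sot (P1 q1)) (U : set (sot (P1 q1))) :
  nbhs t U <-> exists n, forall s, sot_near q n (mx_of (\val t)) (mx_of (\val s)) -> U s.
Proof.
split=> [tU|[n nU]].
  pose near n (s : P1 q1) := sot_near q n (mx_of (\val t)) (mx_of (\val s)).
  have FF : Filter (near_filter near).
    by apply: near_filter_filter => m n s; exact: sot_near_antitone.
  have : @cvg_to (sot (P1 q1)) (near_filter near) (nbhs t).
    apply/(@cvg_sotP _ _ _ (near_filter near) t FF) => x.
    apply/cvgrPdist_lt => e e0.
    have [n nP] := col_near_pointwise q_gt1 x (P1P t) e0.
    exists n => s ns; rewrite sub0r normrN ger0_norm ?Rnorm_ge0//.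
    by apply: nP => //; exact: P1P.
  by move=> /(_ U tU).
have /(@cvg_sotP _ _ _ (nbhs t) t (nbhs_filter t)) tc : nbhs t --> t by [].
have d0 : 0 < (n.+1%:R^-1 : R) `^ q^-1 by rewrite powR_gt0 ?invr_gt0.
have H := @filter_forall_ltn _ (nbhs t) _ n (nbhs_filter t)
  (fun k => nbhs_le_of_cvg0 d0 (tc (basis k))).
apply: filterS H => s sn; apply: nU.
by apply: col_near_of_norms; rewrite ?invr_ge0//; exact: P1P.
Qed.

Lemma nbhs_sot_starP (t : sot_star (P1 q1)) (U : set (sot_star (P1 q1))) :
  nbhs t U <->
  exists n, forall s, sot_star_near q n (mx_of (\val t)) (mx_of (\val s)) -> U s.
Proof.
split=> [tU|[n nU]].
  pose near n (s : P1 q1) := sot_star_near q n (mx_of (\val t)) (mx_of (\val s)).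
  have FF : Filter (near_filter near).
    by apply: near_filter_filter => m n s; exact: sot_star_near_antitone.
  have : @cvg_to (sot_star (P1 q1)) (near_filter near) (nbhs t).
    apply/(@cvg_sot_starP _ _ _ (near_filter near) t FF); split=> [x|f].
      apply/cvgrPdist_lt => e e0.
      have [n nP] := col_near_pointwise q_gt1 x (P1P t) e0.
      exists n => s [ns _]; rewrite sub0r normrN ger0_norm ?Rnorm_ge0//.
      by apply: nP => //; exact: P1P.
    apply/cvgrPdist_lt => e e0.
    have [n nP] := row_near_adjoint q_gt1 f (P1P t) e0.
    exists n => s [_ ns]; rewrite sub0r normrN ger0_norm ?Rnorm_ge0//.
    by apply: nP => //; exact: P1P.
  by move=> /(_ U tU).
have /(@cvg_sot_starP _ _ _ (nbhs t) t (nbhs_filter t))[tc tr] : nbhs t --> t by [].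
have d0 : 0 < (n.+1%:R^-1 : R) `^ q^-1 by rewrite powR_gt0 ?invr_gt0.
have e0 : 0 < (n.+1%:R^-1 : R) by rewrite invr_gt0.
have H1 := @filter_forall_ltn _ (nbhs t) _ n (nbhs_filter t)
  (fun k => nbhs_le_of_cvg0 d0 (tc (basis k))).
have H2 := @filter_forall_ltn _ (nbhs t) _ n (nbhs_filter t)
  (fun j => nbhs_le_of_cvg0 e0 (tr (coord j))).
apply: filterS (filterI H1 H2) => s [sn rn]; apply: nU; split.
  by apply: col_near_of_norms; rewrite ?invr_ge0//; exact: P1P.
by apply: row_near_of_norms => //; exact: P1P.
Qed.

Lemma P1_of_mx (a : nat -> nat -> R) : contractive q a ->
  exists t : P1 q1, mx_of (\val t) = a.
Proof.
move=> /(op_of_mx (q1 := q1) q_gt1)[T TP Ta].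
by exists (exist _ T (mem_set TP)).
Qed.

Let mxc (t : P1 q1) : contractive q (mx_of (\val t)).
Proof. by apply: mx_of_contractive; exact: P1P. Qed.

Lemma baire_sot : baire (sot (P1 q1)).
Proof.
apply: (@baire_of_mx_near _ _ q_gt1 (sot (P1 q1)) (fun t : P1 q1 => mx_of (\val t)) (sot_near q)) => //.
- exact: P1_of_mx.
- exact: nbhs_sotP.
- by move=> *; apply: sot_near_antitone; eassumption.
- exact: sot_near_refl.
- exact: sot_near_closed.
Qed.

Lemma baire_sot_star : baire (sot_star (P1 q1)).
Proof.
apply: (@baire_of_mx_near _ _ q_gt1 (sot_star (P1 q1)) (fun t : P1 q1 => mx_of (\val t)) (sot_star_near q)) => //.
- exact: P1_of_mx.
- exact: nbhs_sot_starP.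
- by move=> *; apply: sot_star_near_antitone; eassumption.
- exact: sot_star_near_refl.
- by move=> n a b [].
- exact: sot_star_near_closed.
Qed.

Lemma sot_star_finer : continuous (id : sot_star (P1 q1) -> sot (P1 q1)).
Proof.
move=> t U /nbhs_sotP[n nU]; apply/nbhs_sot_starP.
by exists n => s [/nU].
Qed.

(** The points near which columns control rows supply the centre of a SOT-open set,
which then lies in a prescribed SOT* neighbourhood. *)
Lemma sot_open_in_sot_star_open (U : set (sot_star (P1 q1))) : open U -> U !=set0 ->
  exists V : set (sot (P1 q1)), [/\ open V, V !=set0 & (id : sot_star (P1 q1) -> sot (P1 q1)) @^-1` V `<=` U].
Proof.
move=> Uo [t Ut].
have /nbhs_sot_starP[n nU] : nbhs t U by exact: open_nbhs_nbhs.
have n0 : 0 < (n.+1%:R^-1 : R) by rewrite invr_gt0.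
have [b [m [d [bc d0 bP]]]] := col_near_controls_row_near q_gt1 n (mxc t) n0.
have [s sb] := P1_of_mx bc.
have [p mp pd] := small_inv_succ m d0.
pose B : set (sot (P1 q1)) := [set r | sot_near q p (mx_of (\val (s : P1 q1))) (mx_of (\val (r : P1 q1)))].
have sB : nbhs (s : sot (P1 q1)) B by apply/nbhs_sotP; exists p.
exists (interior B); split; [exact: open_interior|by exists s|].
move=> r /= /interior_subset; rewrite /B /= sb => br.
apply: nU; apply: bP => // k J km.
apply: le_trans pd; exact: br (leq_trans km mp).
Qed.

End operator_topologies.

Theorem theorem2p6 (R : realType) (q : R) (q2 : 2 < q) :
  [/\ baire (sot (P1 (ltr2_ler1 q2))),
      baire (sot_star (P1 (ltr2_ler1 q2))) &
      forall A : set (P1 (ltr2_ler1 q2)),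
        @comeager (sot (P1 (ltr2_ler1 q2))) A <->
        @comeager (sot_star (P1 (ltr2_ler1 q2))) A].
Proof.
have q_gt1 : 1 < q by apply: lt_trans q2; rewrite ltr1n.
have Bs := baire_sot (q1 := ltr2_ler1 q2) q_gt1.
have Bss := baire_sot_star (q1 := ltr2_ler1 q2) q_gt1.
split=> // A.
exact: (@comeager_transfer (sot_star (P1 (ltr2_ler1 q2))) (sot (P1 (ltr2_ler1 q2)))
  id id (fun=> erefl) (fun=> erefl) (sot_star_finer q_gt1)
  (sot_open_in_sot_star_open q_gt1) Bss Bs A).
Qed.
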